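(* Let $W^L$ be a fixed state with specific volume $v^L$, hydrodynamical pressure $p_{\mathrm h}^L$ and specific entropy $s_{\mathrm h}^L$. Consider the Rankine–Hugoniot condition for $(v^*,p_{\mathrm h}^* )$, $$\hat e_{\mathrm h}(v^*,p_{\mathrm h}^* )-\hat e_{\mathrm h}(v^L,p_{\mathrm h}^L)+\tfrac12(p_{\mathrm h}^*+p_{\mathrm h}^L)(v^*-v^L)+\hat A_{\mathrm b}(v^*,v^L)=0.\qquad(\mathrm{RH})$$ Then there exists a neighborhood of $(v^L,p_{\mathrm h}^L)$ in which the set of solutions $(v^*,p_{\mathrm h}^* )$ of (RH) is described by a continuously differentiable function $v^*=\xi(p_{\mathrm h}^* )$. This curve can be extended (as a continuously differentiable function of $p_{\mathrm h}^*$) as long as, at the points $(v^*,p_{\mathrm h}^* )$ of the curve, with specific entropy $s_{\mathrm h}^*$, one has $s_{\mathrm h}^*\ge s_{\mathrm h}^L$ and $v^*\le v^L$ for $p_{\mathrm h}^*\ge p_{\mathrm h}^L$ (with reversed inequalities for $p_{\mathrm h}^*\le p_{\mathrm h}^L$), and there exists an entropy value $s_{\mathrm h}^\#$ in the closed interval between $s_{\mathrm h}^L$ and $s_{\mathrm h}^*$ such that $$\min_{\tau}\,\partial_v^2\hat p_{\mathrm h}(\tau,s_{\mathrm h}^\#)\big|_{s_{\mathrm h}}+\min_{\tau}\,\hat p_{\mathrm b}''(\tau)>0,$$ where both minima are over $\tau$ in the closed interval between $v^*$ and $v^L$.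
   Context: $v=1/\rho$ is the specific volume; a hat marks a quantity expressed as a function of $v$. The total pressure is $p=p_{\mathrm h}+p_{\mathrm b}(\rho)$; $p_{\mathrm h}$ is a (smooth) complete equation of state with specific internal energy $e_{\mathrm h}$, specific entropy $s_{\mathrm h}$ and sound speed $a_{\mathrm h}$; $p_{\mathrm b}(\rho)=\rho^2\partial_\rho e_{\mathrm b}(\rho)$, i.e. $\hat e_{\mathrm b}'(v)=-\hat p_{\mathrm b}(v)$. $\hat e_{\mathrm h}(v,p_{\mathrm h})$ is $e_{\mathrm h}$ as a function of $v$ and $p_{\mathrm h}$, and $\hat p_{\mathrm h}(v,s_{\mathrm h})$ is $p_{\mathrm h}$ as a function of $v$ and $s_{\mathrm h}$. Standing assumptions (constants $p_\infty,q\in\mathbb R$): $p_{\mathrm h}>-p_\infty$, $a_{\mathrm h}^2=-v^2\partial_v\hat p_{\mathrm h}|_{s_{\mathrm h}}>0$, $\partial_v^2\hat p_{\mathrm h}|_{s_{\mathrm h}}>0$; $\partial_v\hat e_{\mathrm h}|_{p_{\mathrm h}}\ge p_\infty$, $\partial_{p_{\mathrm h}}\hat e_{\mathrm h}|_v\ge0$, $\partial_{s_{\mathrm h}}\hat p_{\mathrm h}|_v>0$, $\hat e_{\mathrm h}\ge q$, $\lim_{v\to0+}\hat e_{\mathrm h}(v,p_{\mathrm h})=q$; $e_{\mathrm b}$ is $C^3$ and $a_{\mathrm b}^2(\rho)=\partial_\rho p_{\mathrm b}(\rho)\ge0$. Moreover $\hat A_{\mathrm b}(v^*,v):=\hat e_{\mathrm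 b}(v^* )-\hat e_{\mathrm b}(v)+\tfrac12(\hat p_{\mathrm b}(v^* )+\hat p_{\mathrm b}(v))(v^*-v)$. *)

(* Defs.v *)
From Stdlib Require Import Reals.
From Coquelicot Require Import Coquelicot.
Open Scope R_scope.

Definition between (a b x : R) : Prop := Rmin a b <= x <= Rmax a b.

Definition is_min_between (f : R -> R) (a b m : R) : Prop :=
  (exists t, between a b t /\ f t = m) /\
  (forall t, between a b t -> m <= f t).

Definition D1 (f : R -> R -> R) (x y : R) : R := Derive (fun z => f z y) x.
Definition D2 (f : R -> R -> R) (x y : R) : R := Derive (fun z => f x z) y.

Fixpoint Ck_on (k : nat) (U : R -> R -> Prop) (f : R -> R -> R) : Prop :=
  (forall x y, U x y -> continuity_2d_pt f x y) /\
  match k with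
  | O => True
  | S k' =>
      (forall x y, U x y ->
         ex_derive (fun z => f z y) x /\ ex_derive (fun z => f x z) y) /\
      Ck_on k' U (D1 f) /\ Ck_on k' U (D2 f)
  end.

Definition smooth_on (U : R -> R -> Prop) (f : R -> R -> R) : Prop :=
  forall k, Ck_on k U f.

(* A complete equation of state is given by its fundamental relation
   e_h = e_vs v s on a set h_dom of pairs (v, s), together with the change of
   variables s_h = s_vp v p, defined for v > 0 and p > - pinf. *)
Record hydro_eos : Type := HydroEos {
  h_dom : R -> R -> Prop;
  e_vs : R -> R -> R;
  s_vp : R -> R -> R
}.

(* Gibbs relation de = T ds - p dv: p_h is minus the derivative of e_h with
   respect to v at constant s. *)
Definition p_vs (E : hydro_eos) (v s : R) : R := - D1 (e_vs E) v s.

Definition e_vp (E : hydro_eos) (v p : R) : R := e_vs E v (s_vp E v p).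

(* The last two clauses say that (v, s) |-> (v, p_h) is a bijection from h_dom
   onto {v > 0, p_h > - pinf}, with inverse (v, p_h) |-> (v, s_vp v p_h). *)
Record complete_eos (pinf : R) (E : hydro_eos) : Prop := {
  eos_open : forall v s, h_dom E v s -> locally_2d (h_dom E) v s;
  eos_smooth : smooth_on (h_dom E) (e_vs E);
  eos_vs : forall v s, h_dom E v s ->
    0 < v /\ - pinf < p_vs E v s /\ s_vp E v (p_vs E v s) = s;
  eos_vp : forall v p, 0 < v -> - pinf < p ->
    h_dom E v (s_vp E v p) /\ p_vs E v (s_vp E v p) = p
}.

Definition a_h_sqr (E : hydro_eos) (v s : R) : R := - v ^ 2 * D1 (p_vs E) v s.

Definition d2p_vs (E : hydro_eos) (v s : R) : R :=
  Derive_n (fun w => p_vs E w s) 2 v.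

Record hydro_assumptions (pinf q : R) (E : hydro_eos) : Prop := {
  h_sound : forall v s, h_dom E v s -> 0 < a_h_sqr E v s;
  h_convex : forall v s, h_dom E v s -> 0 < d2p_vs E v s;
  h_dp_ds : forall v s, h_dom E v s -> 0 < D2 (p_vs E) v s;
  h_de_dv : forall v p, 0 < v -> - pinf < p -> pinf <= D1 (e_vp E) v p;
  h_de_dp : forall v p, 0 < v -> - pinf < p -> 0 <= D2 (e_vp E) v p;
  h_e_ge : forall v p, 0 < v -> - pinf < p -> q <= e_vp E v p;
  h_e_lim : forall p, - pinf < p ->
    filterlim (fun v => e_vp E v p) (at_right 0) (locally q)
}.

(* Barotropic part: eb is the specific energy as a function of the density. *)
Definition p_b (eb : R -> R) (rho : R) : R := rho ^ 2 * Derive eb rho.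
Definition hat (f : R -> R) (v : R) : R := f (/ v).

Record baro_assumptions (eb : R -> R) : Prop := {
  b_C3 : forall k rho, (k <= 3)%nat -> 0 < rho ->
    ex_derive_n eb k rho /\ continuous (Derive_n eb k) rho;
  b_sound : forall rho, 0 < rho -> 0 <= Derive (p_b eb) rho
}.

Definition A_b (eb : R -> R) (vs v : R) : R :=
  hat eb vs - hat eb v
  + / 2 * (hat (p_b eb) vs + hat (p_b eb) v) * (vs - v).

Definition RH (E : hydro_eos) (eb : R -> R) (vL pL vs ps : R) : Prop :=
  e_vp E vs ps - e_vp E vL pL + / 2 * (ps + pL) * (vs - vL) + A_b eb vs vL = 0.

(* xi is a C^1 curve of solutions v = xi p through (vL, pL), over the open
   interval ]a, b[. *)
Definition solution_curve (pinf : R) (E : hydro_eos) (eb : R -> R) (vL pL : R)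
    (a b : Rbar) (xi : R -> R) : Prop :=
  Rbar_lt a pL /\ Rbar_lt pL b /\ xi pL = vL /\
  forall p : R, Rbar_lt a p -> Rbar_lt p b ->
    - pinf < p /\ 0 < xi p /\ RH E eb vL pL (xi p) p /\
    ex_derive xi p /\ continuous (Derive xi) p.

Definition extension_condition (E : hydro_eos) (eb : R -> R) (vL pL sL v p : R)
    : Prop :=
  let s := s_vp E v p in
  (pL <= p -> sL <= s /\ v <= vL) /\
  (p <= pL -> s <= sL /\ vL <= v) /\
  exists s', between sL s s' /\
  exists mh mb,
    is_min_between (fun t => d2p_vs E t s') v vL mh /\
    is_min_between (Derive_n (hat (p_b eb)) 2) v vL mb /\
    0 < mh + mb.

(* Main.v *)
(* Write the Rankine-Hugoniot function as Phi(p, v). Since d/dv A_b(v, vL) is half the gap at vL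
   between p_b and its tangent at v, d_v Phi = d_v e_h|_p + (p + pL)/2 + gap/2, and the gap is at
   least (min p_b'')/2 (v - vL)^2 >= - (min d_v^2 p_h)/2 (v - vL)^2. On the isentrope s# convexity
   and d_v p_h < 0 give (min d_v^2 p_h)/2 (v - vL)^2 <= |p_h(v, s#) - p_h(vL, s#)| <= |p - pL|, the
   last step because p_h increases with s. With d_v e_h|_p >= pinf this yields
   d_v Phi >= pinf + min(p, pL), a positive bound that survives at the end of the curve.
   The volume stays away from 0 (as e_h -> q there) and from infinity, so the curve has a cluster
   point at its end, and the implicit function theorem at that point continues it. *)

Require Import Defs.
From Stdlib Require Import Reals Lra Lia Ranalysis5.
From Stdlib Require Import Classical ClassicalEpsilon FunctionalExtensionality.
From Coquelicot Require Import Coquelicot.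
Open Scope R_scope.

(** * Implicit functions of two variables *)

(** The difficulty sits at the end of the curve. The extension condition is assumed only strictly
    before the end pressure and [xi] is not known to be monotone, so neither a limit volume nor the
    condition itself is available there. What survives is a closed inequality with one constant for
    the whole curve: the derivative in v is at least [pinf + pL] on the compression side and
    [pinf + a] on the expansion side. A cluster point can replace the limit because the implicit
    function theorem is stated with a branch confined to half of its uniqueness box: a curve that
    meets the box once cannot leave the branch without crossing a forbidden gap. A second obstacle
    is the equation of state itself. [s_vp] is given as a bare inverse and [h_dom] as an arbitrary
    open set, so the regularity of [s_vp] has to be recovered from the strict monotonicity of p_h in
    s, and the isentrope s# has to be shown to run inside the domain before convexity can be used on
    it. *)

Lemma is_derive_eps (f : R -> R) (x l : R) :
  is_derive f x l <->
  (forall eps, 0 < eps -> exists d, 0 < d /\ forall t, Rabs (t - x) < d ->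
     Rabs (f t - f x - l * (t - x)) <= eps * Rabs (t - x)).
Proof.
split.
- intros [_ H] eps heps.
  destruct (H x (fun P HP => HP) (mkposreal eps heps)) as [d Hd].
  exists d; split; [apply cond_pos|]. intros t ht.
  specialize (Hd t ht). unfold norm, minus, plus, scal, opp in Hd; simpl in Hd.
  unfold abs, mult in Hd; simpl in Hd.
  replace (f t - f x - l * (t - x)) with (f t + - f x + - ((t + - x) * l)) by ring.
  exact Hd.
- intros H. split; [apply is_linear_scal_l|].
  intros y hy.
  rewrite <- (is_filter_lim_locally_unique (K := R_AbsRing) (V := R_NormedModule) x y hy).
  intros eps. destruct (H eps (cond_pos eps)) as [d [hd Hd]].
  exists (mkposreal d hd). intros t ht. specialize (Hd t ht).
  unfold norm, minus, plus, scal, opp; simpl. unfold abs, mult; simpl.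
  replace (f t + - f x + - ((t + - x) * l)) with (f t - f x - l * (t - x)) by ring.
  exact Hd.
Qed.

Lemma continuous_eps (f : R -> R) (x : R) :
  continuous f x <->
  (forall eps, 0 < eps -> exists d, 0 < d /\ forall t, Rabs (t - x) < d ->
     Rabs (f t - f x) < eps).
Proof.
split.
- intros H eps heps.
  destruct (H (fun y => Rabs (y - f x) < eps)) as [d Hd].
  { exists (mkposreal eps heps). intros y hy. exact hy. }
  exists d; split; [apply cond_pos|]. exact Hd.
- intros H P [eps HP]. destruct (H eps (cond_pos eps)) as [d [hd Hd]].
  exists (mkposreal d hd). intros t ht. apply HP. exact (Hd t ht).
Qed.

(** Continuity of [g] suffices: with h and k the increments of t and [g], the expansion of [F]
    bounds [ly * k - (dc - lx * du) * h] by a small multiple of |h| + |k|, and the |k| part is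
    absorbed since [ly <> 0]. The free curve [u] and right-hand side [c] let one lemma serve the
    implicit function and both partial derivatives of [s_vp]. *)
Lemma implicit_derive (F : R -> R -> R) (u g c : R -> R) (t0 lx ly du dc : R) :
  differentiable_pt_lim F (u t0) (g t0) lx ly -> ly <> 0 ->
  is_derive u t0 du -> is_derive c t0 dc -> continuous g t0 ->
  locally t0 (fun t => F (u t) (g t) = c t) ->
  is_derive g t0 ((dc - lx * du) / ly).
Proof.
intros HF hly Hu Hc Hg [dl HL].
rewrite is_derive_eps in Hu, Hc. rewrite continuous_eps in Hg.
apply is_derive_eps. intros eps heps.
set (a := Rabs ly). assert (ha : 0 < a) by (apply Rabs_pos_lt; auto).
set (m := Rabs (dc - lx * du)). set (B := Rabs du + 2 + Rabs lx).
set (K := 2 / a * (m + B)).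
pose proof (Rabs_pos (dc - lx * du)) as hm. fold m in hm.
assert (hB : 2 <= B) by (pose proof (Rabs_pos du); pose proof (Rabs_pos lx); unfold B; lra).
assert (hia : 0 < / a) by (apply Rinv_0_lt_compat; auto).
assert (hK : 0 <= K) by (unfold K, Rdiv; apply Rmult_le_pos; lra).
(* The bound [a / 2] absorbs the |k| term, 1 keeps the auxiliary errors bounded, and the third turns
   the final error [e * (B + K)] into at most [eps * a], with [a] the modulus of the divisor
   [ly]. *)
set (e := Rmin (Rmin (a / 2) 1) (eps * a / (B + K))).
assert (he : 0 < e).
{ unfold e. repeat apply Rmin_pos; try lra.
  apply Rdiv_lt_0_compat; [|lra]. apply Rmult_lt_0_compat; lra. }
assert (he1 : e <= a / 2) by (unfold e; eapply Rle_trans; [apply Rmin_l|apply Rmin_l]).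
assert (he2 : e <= 1) by (unfold e; eapply Rle_trans; [apply Rmin_l|apply Rmin_r]).
assert (he3 : e * (B + K) <= eps * a).
{ apply (Rmult_le_reg_r (/ (B + K))); [apply Rinv_0_lt_compat; lra|].
  rewrite Rmult_assoc, Rinv_r, Rmult_1_r by lra. apply Rmin_r. }
clearbody e.
destruct (HF (mkposreal e he)) as [d1 H1]. simpl in H1.
destruct (Hu e he) as [d2 [hd2 H2]]. destruct (Hc e he) as [d3 [hd3 H3]].
destruct (Hg d1 (cond_pos d1)) as [d4 [hd4 H4]].
assert (Hcu : exists d5, 0 < d5 /\ forall t, Rabs (t - t0) < d5 -> Rabs (u t - u t0) < d1).
{ exists (Rmin d2 (d1 / (Rabs du + 2))).
  assert (hd : 0 < Rabs du + 2) by (pose proof (Rabs_pos du); lra).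
  split.
  - apply Rmin_pos; auto. apply Rdiv_lt_0_compat; auto. apply cond_pos.
  - intros t ht.
    assert (h1 := Rlt_le_trans _ _ _ ht (Rmin_l _ _)).
    assert (h2 := Rlt_le_trans _ _ _ ht (Rmin_r _ _)).
    specialize (H2 t h1).
    apply (Rmult_lt_compat_r (Rabs du + 2)) in h2; auto.
    unfold Rdiv in h2. rewrite Rmult_assoc, Rinv_l, Rmult_1_r in h2 by lra.
    pose proof (Rabs_triang (u t - u t0 - du * (t - t0)) (du * (t - t0))) as h3.
    rewrite Rabs_mult in h3.
    replace (u t - u t0 - du * (t - t0) + du * (t - t0)) with (u t - u t0) in h3 by ring.
    pose proof (Rabs_pos (t - t0)). nra. }
destruct Hcu as [d5 [hd5 H5]].
exists (Rmin dl (Rmin (Rmin d2 d3) (Rmin d4 d5))). split.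
{ repeat apply Rmin_pos; auto. apply cond_pos. }
intros t ht.
assert (hl := Rlt_le_trans _ _ _ ht (Rmin_l _ _)).
assert (ht' := Rlt_le_trans _ _ _ ht (Rmin_r _ _)).
assert (ht1 := Rlt_le_trans _ _ _ ht' (Rmin_l _ _)).
assert (ht2 := Rlt_le_trans _ _ _ ht' (Rmin_r _ _)).
specialize (H2 t (Rlt_le_trans _ _ _ ht1 (Rmin_l _ _))).
specialize (H3 t (Rlt_le_trans _ _ _ ht1 (Rmin_r _ _))).
specialize (H4 t (Rlt_le_trans _ _ _ ht2 (Rmin_l _ _))).
specialize (H5 t (Rlt_le_trans _ _ _ ht2 (Rmin_r _ _))).
specialize (H1 (u t) (g t) H5 H4).
rewrite (HL t hl), (locally_singleton t0 _ (ex_intro _ dl HL)) in H1.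
clear H4 H5 ht ht' ht1 ht2 hl HL HF Hu Hc Hg.
set (h := t - t0) in *. set (k := g t - g t0) in *.
set (U := u t - u t0) in *. set (C := c t - c t0) in *.
assert (hU : Rabs U <= (Rabs du + 1) * Rabs h).
{ pose proof (Rabs_triang (U - du * h) (du * h)) as h3. rewrite Rabs_mult in h3.
  replace (U - du * h + du * h) with U in h3 by ring.
  pose proof (Rabs_pos h). nra. }
assert (hmx : Rmax (Rabs U) (Rabs k) <= Rabs U + Rabs k).
{ apply Rmax_lub; pose proof (Rabs_pos U); pose proof (Rabs_pos k); lra. }
assert (hkey : Rabs (ly * k - (dc - lx * du) * h) <= e * (B * Rabs h + Rabs k)).
{ replace (ly * k - (dc - lx * du) * h)
    with (- (C - (lx * U + ly * k)) + ((C - dc * h) + - (lx * (U - du * h)))) by ring.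
  eapply Rle_trans; [apply Rabs_triang|]. rewrite Rabs_Ropp.
  eapply Rle_trans; [apply Rplus_le_compat; [exact H1|apply Rabs_triang]|].
  rewrite Rabs_Ropp, Rabs_mult. unfold B.
  assert (Rabs lx * Rabs (U - du * h) <= Rabs lx * (e * Rabs h))
    by (apply Rmult_le_compat_l; [apply Rabs_pos|auto]).
  assert (e * Rmax (Rabs U) (Rabs k) <= e * ((Rabs du + 1) * Rabs h + Rabs k))
    by (apply Rmult_le_compat_l; lra).
  nra. }
assert (hk : Rabs k <= K * Rabs h).
{ pose proof (Rabs_triang (ly * k - (dc - lx * du) * h) ((dc - lx * du) * h)) as h3.
  replace (ly * k - (dc - lx * du) * h + (dc - lx * du) * h) with (ly * k) in h3 by ring.
  rewrite !Rabs_mult in h3. fold a m in h3.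
  assert (h4 : a / 2 * Rabs k <= (m + B) * Rabs h).
  { pose proof (Rabs_pos k). pose proof (Rabs_pos h).
    assert (e * Rabs k <= a / 2 * Rabs k) by (apply Rmult_le_compat_r; lra).
    assert (e * (B * Rabs h) <= 1 * (B * Rabs h))
      by (apply Rmult_le_compat_r; [apply Rmult_le_pos; lra|lra]).
    lra. }
  apply (Rmult_le_compat_l (2 / a)) in h4; [|unfold Rdiv; lra].
  unfold K. replace (2 / a * (a / 2 * Rabs k)) with (Rabs k) in h4 by (field; lra).
  lra. }
replace (k - (dc - lx * du) / ly * h) with ((ly * k - (dc - lx * du) * h) / ly)
  by (field; auto).
unfold Rdiv. rewrite Rabs_mult, Rabs_inv. fold a.
apply (Rmult_le_reg_r a); auto. rewrite Rmult_assoc, Rinv_l, Rmult_1_r by lra.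
eapply Rle_trans; [exact hkey|].
pose proof (Rabs_pos h).
assert (e * (B * Rabs h + Rabs k) <= e * (B + K) * Rabs h) by nra.
assert (e * (B + K) * Rabs h <= eps * a * Rabs h) by (apply Rmult_le_compat_r; lra).
lra.
Qed.

Lemma Ck1_differentiable (U : R -> R -> Prop) (F : R -> R -> R) (x y : R) :
  locally_2d U x y -> Ck_on 1 U F ->
  differentiable_pt_lim F x y (D1 F x y) (D2 F x y).
Proof.
intros HU [_ [Hd [[Hc1 _] _]]].
assert (hxy : U x y) by exact (locally_2d_singleton _ _ _ HU).
apply filterdiff_differentiable_pt_lim.
apply (is_derive_filterdiff F x y (D1 F) (D2 F x y)).
- apply locally_2d_locally in HU. revert HU. apply filter_imp.
  intros [u v] huv. simpl in *. apply Derive_correct. exact (proj1 (Hd u v huv)).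
- apply Derive_correct. exact (proj2 (Hd x y hxy)).
- apply (continuity_2d_pt_filterlim (D1 F)). apply Hc1. exact hxy.
Qed.

Lemma increasing_of_derive (f : R -> R) (a b : R) :
  a < b -> (forall t, a <= t <= b -> ex_derive f t /\ 0 < Derive f t) -> f a < f b.
Proof.
intros hab H.
destruct (MVT_gen f a b (Derive f)) as [c [hc Hc]].
- rewrite Rmin_left, Rmax_right by lra. intros t ht. apply Derive_correct. apply H. lra.
- rewrite Rmin_left, Rmax_right by lra. intros t ht. apply continuity_pt_filterlim.
  apply (ex_derive_continuous (V := R_NormedModule)). apply H. lra.
- rewrite Rmin_left, Rmax_right in hc by lra.
  destruct (H c hc) as [_ h]. assert (0 < Derive f c * (b - a)) by (apply Rmult_lt_0_compat; lra).
  lra.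
Qed.

Lemma increment_ge (f : R -> R) (a b m : R) :
  a <= b -> (forall t, a <= t <= b -> ex_derive f t /\ m <= Derive f t) ->
  m * (b - a) <= f b - f a.
Proof.
intros hab H.
destruct (MVT_gen f a b (Derive f)) as [c [hc Hc]].
- rewrite Rmin_left, Rmax_right by lra. intros t ht. apply Derive_correct. apply H. lra.
- rewrite Rmin_left, Rmax_right by lra. intros t ht. apply continuity_pt_filterlim.
  apply (ex_derive_continuous (V := R_NormedModule)). apply H. lra.
- rewrite Rmin_left, Rmax_right in hc by lra.
  destruct (H c hc) as [_ h]. rewrite Hc. apply Rmult_le_compat_r; lra.
Qed.

(** [D2 F] stays positive on a short vertical segment, so [F x1] passes strictly through its value
    there; the strict signs at the two ends survive small changes of [x] and of the target [z], and
    the intermediate value theorem gives a root. The variable target serves the inversion of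
    [p_vs]. *)
Lemma local_solvability (U : R -> R -> Prop) (F : R -> R -> R) (x1 y1 : R) :
  locally_2d U x1 y1 -> Ck_on 1 U F -> 0 < D2 F x1 y1 ->
  forall eps, 0 < eps -> exists d, 0 < d /\
    forall x z, Rabs (x - x1) < d -> Rabs (z - F x1 y1) < d ->
    exists y, Rabs (y - y1) < eps /\ U x y /\ F x y = z.
Proof.
intros HU [Hc [Hd [_ [Hc2 _]]]] hpos eps heps.
assert (hxy : U x1 y1) by exact (locally_2d_singleton _ _ _ HU).
destruct HU as [r0 HU].
destruct (Hc2 x1 y1 hxy (mkposreal _ hpos)) as [r1 H1]. simpl in H1.
set (k := Rmin eps (Rmin r0 r1) / 2).
assert (hk : 0 < k).
{ unfold k. assert (0 < Rmin eps (Rmin r0 r1)); [|lra].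
  repeat apply Rmin_pos; auto; apply cond_pos. }
assert (hk0 : k < eps /\ k < r0 /\ k < r1).
{ pose proof (Rmin_l eps (Rmin r0 r1)). pose proof (Rmin_r eps (Rmin r0 r1)).
  pose proof (Rmin_l r0 r1). pose proof (Rmin_r r0 r1). unfold k in *. lra. }
destruct hk0 as [hk1 [hk2 hk3]].
assert (hr0 := cond_pos r0). assert (hr1 := cond_pos r1).
assert (hin : forall y, y1 - k <= y <= y1 + k -> U x1 y /\ 0 < D2 F x1 y).
{ intros y hy. assert (Rabs (y - y1) <= k) by (apply Rabs_le; lra).
  assert (Rabs (x1 - x1) = 0) by (rewrite Rminus_diag; apply Rabs_R0).
  split; [apply HU; lra|].
  assert (h := H1 x1 y ltac:(lra) ltac:(lra)). apply Rabs_def2 in h. lra. }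
assert (hlo : F x1 (y1 - k) < F x1 y1).
{ apply increasing_of_derive; [lra|]. intros t ht. destruct (hin t ltac:(lra)). split; auto.
  apply Hd; auto. }
assert (hhi : F x1 y1 < F x1 (y1 + k)).
{ apply increasing_of_derive; [lra|]. intros t ht. destruct (hin t ltac:(lra)). split; auto.
  apply Hd; auto. }
(* Half of the smaller gap: one [e] pays for moving the end values from [x1] to [x], the other for
   moving the target to [z]. *)
set (e := Rmin (F x1 y1 - F x1 (y1 - k)) (F x1 (y1 + k) - F x1 y1) / 2).
assert (he : 0 < e).
{ unfold e. assert (0 < Rmin (F x1 y1 - F x1 (y1 - k)) (F x1 (y1 + k) - F x1 y1)); [|lra].
  apply Rmin_pos; lra. }
assert (he1 : 2 * e <= F x1 y1 - F x1 (y1 - k)).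
{ pose proof (Rmin_l (F x1 y1 - F x1 (y1 - k)) (F x1 (y1 + k) - F x1 y1)). unfold e. lra. }
assert (he2 : 2 * e <= F x1 (y1 + k) - F x1 y1).
{ pose proof (Rmin_r (F x1 y1 - F x1 (y1 - k)) (F x1 (y1 + k) - F x1 y1)). unfold e. lra. }
clearbody e.
destruct (Hc x1 (y1 - k) (proj1 (hin (y1 - k) ltac:(lra))) (mkposreal e he)) as [d1 G1].
destruct (Hc x1 (y1 + k) (proj1 (hin (y1 + k) ltac:(lra))) (mkposreal e he)) as [d2 G2].
simpl in G1, G2.
exists (Rmin (Rmin e r0) (Rmin d1 d2)). split.
{ repeat apply Rmin_pos; auto; apply cond_pos. }
intros x z hx hz.
assert (hd : Rmin (Rmin e r0) (Rmin d1 d2) <= e /\ Rmin (Rmin e r0) (Rmin d1 d2) <= r0 /\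
  Rmin (Rmin e r0) (Rmin d1 d2) <= d1 /\ Rmin (Rmin e r0) (Rmin d1 d2) <= d2).
{ pose proof (Rmin_l (Rmin e r0) (Rmin d1 d2)). pose proof (Rmin_r (Rmin e r0) (Rmin d1 d2)).
  pose proof (Rmin_l e r0). pose proof (Rmin_r e r0).
  pose proof (Rmin_l d1 d2). pose proof (Rmin_r d1 d2). lra. }
assert (g1 := G1 x (y1 - k) ltac:(lra) ltac:(rewrite Rminus_diag, Rabs_R0; apply cond_pos)).
assert (g2 := G2 x (y1 + k) ltac:(lra) ltac:(rewrite Rminus_diag, Rabs_R0; apply cond_pos)).
apply Rabs_def2 in g1, g2, hz.
assert (hU : forall y, y1 - k <= y <= y1 + k -> U x y).
{ intros y hy. assert (Rabs (y - y1) <= k) by (apply Rabs_le; lra). apply HU; lra. }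
destruct (IVT_interv (fun y => F x y - z) (y1 - k) (y1 + k)) as [y [hy Hy]].
- intros y hy. apply continuity_pt_minus; [|apply continuity_pt_const; intros ? ?; reflexivity].
  apply continuity_pt_filterlim, (ex_derive_continuous (V := R_NormedModule)).
  apply (Hd x y (hU y hy)).
- lra.
- lra.
- lra.
- exists y. split; [apply Rle_lt_trans with k; [apply Rabs_le; lra|lra]|].
  split; [auto|lra].
Qed.

Lemma continuity_2d_pt_comp_2 (f g h : R -> R -> R) (x y : R) :
  continuity_2d_pt f (g x y) (h x y) -> continuity_2d_pt g x y -> continuity_2d_pt h x y ->
  continuity_2d_pt (fun u v => f (g u v) (h u v)) x y.
Proof.
intros Hf Hg Hh eps. destruct (Hf eps) as [d Hd].
destruct (Hg d) as [d1 H1]. destruct (Hh d) as [d2 H2].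
assert (hm : 0 < Rmin d1 d2) by (apply Rmin_pos; apply cond_pos).
exists (mkposreal _ hm). simpl. intros u v hu hv.
pose proof (Rmin_l d1 d2). pose proof (Rmin_r d1 d2).
apply Hd; [apply H1|apply H2]; lra.
Qed.

Lemma continuity_2d_pt_graph (f : R -> R -> R) (g : R -> R) (x : R) :
  continuity_2d_pt f x (g x) -> continuous g x -> continuous (fun t => f t (g t)) x.
Proof.
intros Hf Hg. rewrite continuous_eps in Hg. apply continuous_eps. intros eps heps.
destruct (Hf (mkposreal eps heps)) as [d Hd].
destruct (Hg d (cond_pos d)) as [d1 [hd1 H1]].
exists (Rmin d d1). split; [apply Rmin_pos; auto; apply cond_pos|]. intros t ht.
pose proof (Rmin_l d d1). pose proof (Rmin_r d d1).
apply Hd; [lra|]. apply H1. lra.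
Qed.

(** The branch stays in the half box while uniqueness holds in the full box. This margin is spent
    twice: on the continuity of [g] and, later, on separating [g] from any other solution curve. *)
Lemma implicit_function (U : R -> R -> Prop) (F : R -> R -> R) (x0 y0 r : R) :
  (forall x y, U x y -> locally_2d U x y) -> Ck_on 1 U F ->
  U x0 y0 -> F x0 y0 = 0 -> 0 < D2 F x0 y0 -> 0 < r ->
  exists (eps delta : R) (g : R -> R),
    0 < eps <= r /\ 0 < delta <= r /\
    (forall x, Rabs (x - x0) < delta ->
       Rabs (g x - y0) < eps / 2 /\ U x (g x) /\ F x (g x) = 0 /\
       ex_derive g x /\ continuous (Derive g) x) /\
    (forall x y, Rabs (x - x0) < delta -> Rabs (y - y0) < eps -> F x y = 0 -> y = g x).
Proof.
intros HU HF hU0 hF0 hpos hr.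
assert (HF' := HF). destruct HF' as [Hc [Hd [[Hc1 _] [Hc2 _]]]].
destruct (HU x0 y0 hU0) as [r0 HU0].
destruct (Hc2 x0 y0 hU0 (mkposreal _ hpos)) as [r1 H1]. simpl in H1.
set (eps := Rmin r (Rmin r0 r1)).
assert (hr0 := cond_pos r0). assert (hr1 := cond_pos r1).
assert (heps : 0 < eps) by (unfold eps; repeat apply Rmin_pos; auto).
assert (hle : eps <= r /\ eps <= r0 /\ eps <= r1).
{ pose proof (Rmin_l r (Rmin r0 r1)). pose proof (Rmin_r r (Rmin r0 r1)).
  pose proof (Rmin_l r0 r1). pose proof (Rmin_r r0 r1). unfold eps in *. lra. }
clearbody eps.
assert (hbox : forall x y, Rabs (x - x0) < eps -> Rabs (y - y0) < eps ->
   U x y /\ 0 < D2 F x y).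
{ intros x y hx hy. split; [apply HU0; lra|].
  assert (h := H1 x y ltac:(lra) ltac:(lra)). apply Rabs_def2 in h. lra. }
assert (huniq : forall x y y', Rabs (x - x0) < eps -> Rabs (y - y0) < eps ->
   Rabs (y' - y0) < eps -> F x y = 0 -> F x y' = 0 -> y = y').
{ assert (hlt : forall x y y', Rabs (x - x0) < eps -> Rabs (y - y0) < eps ->
     Rabs (y' - y0) < eps -> F x y = 0 -> F x y' = 0 -> ~ y < y').
  { intros x y y' hx hy hy' e1 e2 hl.
    apply Rabs_def2 in hy, hy'.
    assert (F x y < F x y'); [|lra].
    apply increasing_of_derive; auto. intros t ht.
    destruct (hbox x t hx ltac:(apply Rabs_def1; lra)). split; auto. apply Hd; auto. }
  intros x y y' hx hy hy' e1 e2. destruct (Rtotal_order y y') as [h|[h|h]]; auto; exfalso.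
  - exact (hlt x y y' hx hy hy' e1 e2 h).
  - exact (hlt x y' y hx hy' hy e2 e1 h). }
destruct (local_solvability U F x0 y0 (HU _ _ hU0) HF hpos (eps / 2) ltac:(lra))
  as [d [hd Hsol]].
set (delta := Rmin d eps).
assert (hdelta : 0 < delta) by (apply Rmin_pos; auto).
assert (hdle : delta <= d /\ delta <= eps) by (split; [apply Rmin_l|apply Rmin_r]).
clearbody delta.
set (g := fun x => epsilon (inhabits 0) (fun y => Rabs (y - y0) < eps / 2 /\ F x y = 0)).
assert (hg : forall x, Rabs (x - x0) < delta -> Rabs (g x - y0) < eps / 2 /\ F x (g x) = 0).
{ intros x hx. unfold g. apply epsilon_spec.
  destruct (Hsol x 0 ltac:(lra)) as [y [hy [_ hy']]].
  { rewrite hF0, Rminus_diag, Rabs_R0. auto. }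
  exists y. auto. }
clearbody g.
(* [g] is chosen point by point, so continuity must come from uniqueness: for t near x there is a
   root within [Rmin e (eps / 2)] of [g x]; it still lies in the full box and is therefore [g t]. *)
assert (hgc : forall x, Rabs (x - x0) < delta -> continuous g x).
{ intros x hx. apply continuous_eps. intros e he.
  destruct (hg x hx) as [hgx hFx].
  destruct (hbox x (g x) ltac:(lra) ltac:(lra)) as [hUx hpx].
  destruct (local_solvability U F x (g x) (HU _ _ hUx) HF hpx (Rmin e (eps / 2)))
    as [d' [hd' Hs']].
  { apply Rmin_pos; lra. }
  exists (Rmin d' (delta - Rabs (x - x0))). split; [apply Rmin_pos; lra|].
  intros t ht. pose proof (Rmin_l d' (delta - Rabs (x - x0))).
  pose proof (Rmin_r d' (delta - Rabs (x - x0))).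
  assert (ht0 : Rabs (t - x0) < delta).
  { replace (t - x0) with ((t - x) + (x - x0)) by ring.
    eapply Rle_lt_trans; [apply Rabs_triang|]. lra. }
  destruct (Hs' t 0 ltac:(lra)) as [y [hy [_ hFy]]].
  { rewrite hFx, Rminus_diag, Rabs_R0. auto. }
  pose proof (Rmin_l e (eps / 2)). pose proof (Rmin_r e (eps / 2)).
  destruct (hg t ht0) as [hgt hFt].
  rewrite (huniq t (g t) y); auto; try lra.
  replace (y - y0) with ((y - g x) + (g x - y0)) by ring.
  eapply Rle_lt_trans; [apply Rabs_triang|]. lra. }
assert (hloc : forall x, Rabs (x - x0) < delta -> locally x (fun t => Rabs (t - x0) < delta)).
{ intros x hx. assert (h : 0 < delta - Rabs (x - x0)) by lra.
  exists (mkposreal _ h). intros t ht.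
  change (Rabs (t - x) < delta - Rabs (x - x0)) in ht.
  replace (t - x0) with ((t - x) + (x - x0)) by ring.
  eapply Rle_lt_trans; [apply Rabs_triang|]. lra. }
assert (hgd : forall x, Rabs (x - x0) < delta ->
   is_derive g x (- D1 F x (g x) / D2 F x (g x))).
{ intros x hx. destruct (hg x hx) as [hgx hFx].
  destruct (hbox x (g x) ltac:(lra) ltac:(lra)) as [hUx hpx].
  replace (- D1 F x (g x) / D2 F x (g x))
    with ((0 - D1 F x (g x) * 1) / D2 F x (g x)) by (field; lra).
  apply (implicit_derive F (fun t => t) g (fun _ => 0)).
  - apply (Ck1_differentiable U); auto.
  - lra.
  - apply (is_derive_id (K := R_AbsRing)).
  - apply (is_derive_const (K := R_AbsRing) (V := R_NormedModule)).
  - auto.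
  - generalize (hloc x hx). apply filter_imp. intros t ht. apply hg; auto. }
exists eps, delta, g. split; [lra|]. split; [lra|]. split.
- intros x hx. destruct (hg x hx) as [hgx hFx].
  destruct (hbox x (g x) ltac:(lra) ltac:(lra)) as [hUx hpx].
  repeat split; auto.
  + eexists. apply hgd; auto.
  + apply (continuous_ext_loc _ (fun t => - D1 F t (g t) / D2 F t (g t))).
    { generalize (hloc x hx). apply filter_imp. intros t ht. symmetry.
      apply is_derive_unique. apply hgd; auto. }
    apply (continuity_2d_pt_graph (fun u v => - D1 F u v / D2 F u v)); auto.
    apply continuity_2d_pt_mult.
    * apply continuity_2d_pt_opp. apply Hc1; auto.
    * apply continuity_2d_pt_inv; [apply Hc2; auto|lra].
- intros x y hx hy hFy. destruct (hg x hx) as [hgx hFx].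
  apply (huniq x); auto; lra.
Qed.

(** Closeness to [y0] is asked of [xi] at the single point [p1], which is all that a cluster point
    provides at the end of a curve. *)
Lemma branch_unique (F : R -> R -> R) (g xi : R -> R) (x0 y0 eps delta p1 p2 : R) :
  (forall x, Rabs (x - x0) < delta -> Rabs (g x - y0) < eps / 2 /\ continuous g x) ->
  (forall x y, Rabs (x - x0) < delta -> Rabs (y - y0) < eps -> F x y = 0 -> y = g x) ->
  Rabs (p1 - x0) < delta -> Rabs (p2 - x0) < delta ->
  (forall x, between p1 p2 x -> continuous xi x /\ F x (xi x) = 0) ->
  Rabs (xi p1 - y0) < eps -> xi p2 = g p2.
Proof.
intros Hg Hu h1 h2 Hxi hp1.
assert (eps_pos : 0 < eps) by (pose proof (Rabs_pos (xi p1 - y0)); lra).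
assert (hb1 : between p1 p2 p1) by (split; [apply Rmin_l|apply Rmax_l]).
assert (hb2 : between p1 p2 p2) by (split; [apply Rmin_r|apply Rmax_r]).
assert (hbx : forall x, between p1 p2 x -> Rabs (x - x0) < delta).
{ intros x [ha hb]. apply Rabs_def2 in h1, h2. apply Rabs_def1;
  unfold Rmin, Rmax in *; destruct (Rle_dec p1 p2); lra. }
assert (e1 : xi p1 = g p1) by (apply Hu; auto; apply Hxi; auto).
(* To leave [g], [xi] would have to jump out of the [eps]-box while [g] stays in the half box. *)
assert (hgap : forall x, between p1 p2 x -> xi x = g x \/ eps / 2 <= Rabs (xi x - g x)).
{ intros x hx. destruct (Rlt_dec (Rabs (xi x - y0)) eps) as [h|h].
  - left. apply Hu; auto. apply Hxi; auto.
  - right. destruct (Hg x (hbx x hx)) as [hgx _].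
    pose proof (Rabs_triang (xi x - g x) (g x - y0)) as ht.
    replace (xi x - g x + (g x - y0)) with (xi x - y0) in ht by ring. lra. }
destruct (hgap p2 hb2) as [h|h]; auto. exfalso.
(* By [hgap] the distance is 0 or at least [eps / 2]; a zero of [f] would give it the excluded value
   [eps / 4]. *)
set (f := fun x => Rabs (xi x - g x) - eps / 4).
assert (hf : forall x, between p1 p2 x -> continuity_pt f x).
{ intros x hx. apply continuity_pt_minus; [|apply continuity_pt_const; intros ? ?; reflexivity].
  apply (continuity_pt_comp (fun x => xi x - g x) Rabs); [|apply Rcontinuity_abs].
  apply continuity_pt_minus; apply continuity_pt_filterlim; [apply Hxi|apply Hg]; auto. }
assert (hf1 : f p1 < 0) by (unfold f; rewrite e1, Rminus_diag, Rabs_R0; lra).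
assert (hf2 : 0 < f p2) by (unfold f; lra).
assert (hz : exists z, between p1 p2 z /\ f z = 0).
{ destruct (Rtotal_order p1 p2) as [hl|[hl|hl]].
  - destruct (IVT_interv f p1 p2) as [z [hz1 hz2]]; auto.
    + intros a ha. apply hf. unfold between. rewrite Rmin_left, Rmax_right; lra.
    + exists z. split; auto. unfold between. rewrite Rmin_left, Rmax_right; lra.
  - subst p2. lra.
  - destruct (IVT_interv (fun x => - f x) p2 p1) as [z [hz1 hz2]]; try lra.
    + intros a ha. apply continuity_pt_opp, hf. unfold between. rewrite Rmin_right, Rmax_left; lra.
    + exists z. split; [|lra]. unfold between. rewrite Rmin_right, Rmax_left; lra. }
destruct hz as [z [hz1 hz2]]. unfold f in hz2.
destruct (hgap z hz1) as [h3|h3]; [|lra].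
rewrite h3, Rminus_diag, Rabs_R0 in hz2. lra.
Qed.

(** The cluster value is the lower limit of [f] at 0+, namely the supremum of the eventual lower
    bounds collected in [S]. The variable [h] stands for the distance to an end of the curve, so
    that both ends share the lemma. *)
Lemma cluster_point (f : R -> R) (r m M : R) :
  0 < r -> (forall h, 0 < h < r -> m <= f h <= M) ->
  exists l, m <= l <= M /\
    forall eps d, 0 < eps -> 0 < d -> exists h, 0 < h < r /\ h < d /\ Rabs (f h - l) < eps.
Proof.
intros hr Hf.
set (S := fun y => exists d, 0 < d <= r /\ forall h, 0 < h < d -> y <= f h).
destruct (completeness S) as [l [hl1 hl2]].
- exists M. intros y [d [hd H]]. specialize (H (d / 2) ltac:(lra)).
  destruct (Hf (d / 2) ltac:(lra)). lra.
- exists m. exists r. split; [lra|]. intros h hh. apply Hf; auto.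
- exists l. split.
  + split.
    * apply hl1. exists r. split; [lra|]. intros h hh. apply Hf; auto.
    * apply hl2. intros y [d [hd H]]. specialize (H (d / 2) ltac:(lra)).
      destruct (Hf (d / 2) ltac:(lra)). lra.
  + intros eps d heps hd.
    assert (h1 : exists y, S y /\ l - eps < y).
    { apply NNPP. intros hn. assert (l <= l - eps); [|lra]. apply hl2. intros y hy.
      destruct (Rle_dec y (l - eps)) as [h|h]; auto. exfalso. apply hn. exists y. split; auto. lra. }
    destruct h1 as [y [[d1 [hd1 H1]] hy]].
    apply NNPP. intros hn.
    assert (hm : 0 < Rmin d d1) by (apply Rmin_pos; lra).
    pose proof (Rmin_l d d1). pose proof (Rmin_r d d1).
    assert (hS : S (l + eps / 2)).
    { exists (Rmin d d1). split; [lra|]. intros h hh.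
      destruct (Rle_dec (l + eps / 2) (f h)) as [h2|h2]; auto. exfalso.
      apply hn. exists h. split; [lra|]. split; [lra|].
      specialize (H1 h ltac:(lra)). apply Rabs_def1; lra. }
    apply hl1 in hS. lra.
Qed.

(** * The equation of state in the variables v, p *)

Lemma Ck_on_opp (k : nat) (U : R -> R -> Prop) (f : R -> R -> R) :
  Ck_on k U f -> Ck_on k U (fun x y => - f x y).
Proof.
revert f. induction k as [|k IH]; intros f H.
- destruct H as [Hc _]. split; auto. intros x y h. apply continuity_2d_pt_opp; auto.
- destruct H as [Hc [Hd [H1 H2]]].
  split; [intros x y h; apply continuity_2d_pt_opp; auto|]. split; [|split].
  + intros x y h. destruct (Hd x y h) as [h1 h2].
    split; apply (ex_derive_opp (K := R_AbsRing) (V := R_NormedModule)); auto.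
  + replace (D1 (fun x y => - f x y)) with (fun x y => - D1 f x y).
    * apply (IH (D1 f)); auto.
    * extensionality x. extensionality y. unfold D1. rewrite Derive_opp. reflexivity.
  + replace (D2 (fun x y => - f x y)) with (fun x y => - D2 f x y).
    * apply (IH (D2 f)); auto.
    * extensionality x. extensionality y. unfold D2. rewrite Derive_opp. reflexivity.
Qed.

Lemma p_vs_Ck (pinf : R) (E : hydro_eos) (k : nat) :
  complete_eos pinf E -> Ck_on k (h_dom E) (p_vs E).
Proof.
intros hE. apply (Ck_on_opp k (h_dom E) (D1 (e_vs E))).
destruct (eos_smooth _ _ hE (S k)) as [_ [_ [H _]]]. exact H.
Qed.

(** Solving [p_vs E v' s = p'] near the known entropy yields a nearby root, and the inverse clause
    [eos_vs] identifies this root with [s_vp E v' p']. *)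
Lemma s_vp_continuous (pinf q : R) (E : hydro_eos) (v p : R) :
  complete_eos pinf E -> hydro_assumptions pinf q E -> 0 < v -> - pinf < p ->
  continuity_2d_pt (s_vp E) v p.
Proof.
intros hE hh hv hp [eps heps].
destruct (eos_vp _ _ hE v p hv hp) as [hd hps].
destruct (local_solvability _ (p_vs E) v (s_vp E v p) (eos_open _ _ hE _ _ hd)
  (p_vs_Ck pinf E 1 hE) (h_dp_ds _ _ _ hh _ _ hd) eps heps) as [d [hd0 H]].
exists (mkposreal d hd0). simpl. intros v' p' hv' hp'.
destruct (H v' p' hv') as [y [hy [hU hF]]]; [rewrite hps; auto|].
destruct (eos_vs _ _ hE v' y hU) as [_ [_ hs]]. rewrite hF in hs. rewrite hs. auto.
Qed.

Lemma locally_gt (c x : R) : c < x -> locally x (fun t => c < t).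
Proof. intros h. exact (open_gt c x h). Qed.

Lemma locally_2d_quadrant (a b x y : R) :
  a < x -> b < y -> locally_2d (fun u v => a < u /\ b < v) x y.
Proof.
intros hx hy. assert (h : 0 < Rmin (x - a) (y - b)) by (apply Rmin_pos; lra).
exists (mkposreal _ h). simpl. intros u v hu hv.
pose proof (Rmin_l (x - a) (y - b)). pose proof (Rmin_r (x - a) (y - b)).
apply Rabs_def2 in hu, hv. lra.
Qed.

Lemma continuity_2d_pt_fst (f : R -> R -> R) (x y : R) :
  continuity_2d_pt f x y -> continuous (fun t => f t y) x.
Proof.
intros H. apply (continuity_2d_pt_graph f (fun _ => y)); auto. apply continuous_const.
Qed.

Lemma continuity_2d_pt_snd (f : R -> R -> R) (x y : R) :
  continuity_2d_pt f x y -> continuous (f x) y.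
Proof.
intros H. apply continuous_eps. intros eps heps.
destruct (H (mkposreal eps heps)) as [d Hd]. exists d. split; [apply cond_pos|].
intros t ht. apply Hd; auto. rewrite Rminus_diag, Rabs_R0. apply cond_pos.
Qed.

Lemma s_vp_derive_v (pinf q : R) (E : hydro_eos) (v p : R) :
  complete_eos pinf E -> hydro_assumptions pinf q E -> 0 < v -> - pinf < p ->
  is_derive (fun w => s_vp E w p) v
    (- D1 (p_vs E) v (s_vp E v p) / D2 (p_vs E) v (s_vp E v p)).
Proof.
intros hE hh hv hp.
destruct (eos_vp _ _ hE v p hv hp) as [hd hps].
assert (hpos := h_dp_ds _ _ _ hh _ _ hd).
replace (- D1 (p_vs E) v (s_vp E v p) / D2 (p_vs E) v (s_vp E v p))
  with ((0 - D1 (p_vs E) v (s_vp E v p) * 1) / D2 (p_vs E) v (s_vp E v p)) by (field; lra).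
apply (implicit_derive (p_vs E) (fun t => t) (fun w => s_vp E w p) (fun _ => p)).
- apply (Ck1_differentiable (h_dom E)); [apply (eos_open _ _ hE); auto|].
  apply (p_vs_Ck pinf); auto.
- lra.
- apply (is_derive_id (K := R_AbsRing)).
- apply (is_derive_const (K := R_AbsRing) (V := R_NormedModule)).
- apply continuity_2d_pt_fst. apply (s_vp_continuous pinf q); auto.
- generalize (locally_gt 0 v hv). apply filter_imp. intros t ht.
  apply (eos_vp _ _ hE); auto.
Qed.

Lemma s_vp_derive_p (pinf q : R) (E : hydro_eos) (v p : R) :
  complete_eos pinf E -> hydro_assumptions pinf q E -> 0 < v -> - pinf < p ->
  is_derive (s_vp E v) p (/ D2 (p_vs E) v (s_vp E v p)).
Proof.
intros hE hh hv hp.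
destruct (eos_vp _ _ hE v p hv hp) as [hd hps].
assert (hpos := h_dp_ds _ _ _ hh _ _ hd).
replace (/ D2 (p_vs E) v (s_vp E v p))
  with ((1 - D1 (p_vs E) v (s_vp E v p) * 0) / D2 (p_vs E) v (s_vp E v p)) by (field; lra).
apply (implicit_derive (p_vs E) (fun _ => v) (s_vp E v) (fun t => t)).
- apply (Ck1_differentiable (h_dom E)); [apply (eos_open _ _ hE); auto|].
  apply (p_vs_Ck pinf); auto.
- lra.
- apply (is_derive_const (K := R_AbsRing) (V := R_NormedModule)).
- apply (is_derive_id (K := R_AbsRing)).
- apply continuity_2d_pt_snd. apply (s_vp_continuous pinf q); auto.
- generalize (locally_gt (- pinf) p hp). apply filter_imp. intros t ht.
  apply (eos_vp _ _ hE); auto.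
Qed.

(** This is the Gibbs relation at constant pressure: [D2 (e_vs E)] is the temperature T, and the
    value reads T ds/dv - p. *)
Lemma e_vp_derive_v (pinf q : R) (E : hydro_eos) (v p : R) :
  complete_eos pinf E -> hydro_assumptions pinf q E -> 0 < v -> - pinf < p ->
  is_derive (fun w => e_vp E w p) v
    (- p + D2 (e_vs E) v (s_vp E v p)
           * (- D1 (p_vs E) v (s_vp E v p) / D2 (p_vs E) v (s_vp E v p))).
Proof.
intros hE hh hv hp.
destruct (eos_vp _ _ hE v p hv hp) as [hd hps].
replace (- p) with (D1 (e_vs E) v (s_vp E v p) * 1) by (unfold p_vs in hps; lra).
apply is_derive_Reals.
apply (derivable_pt_lim_comp_2d (e_vs E) (fun w => w) (fun w => s_vp E w p)).
- apply (Ck1_differentiable (h_dom E)); [apply (eos_open _ _ hE); auto|].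
  apply (eos_smooth _ _ hE).
- apply derivable_pt_lim_id.
- apply is_derive_Reals. apply (s_vp_derive_v pinf q); auto.
Qed.

Lemma e_vp_derive_p (pinf q : R) (E : hydro_eos) (v p : R) :
  complete_eos pinf E -> hydro_assumptions pinf q E -> 0 < v -> - pinf < p ->
  is_derive (e_vp E v) p
    (D2 (e_vs E) v (s_vp E v p) * / D2 (p_vs E) v (s_vp E v p)).
Proof.
intros hE hh hv hp.
destruct (eos_vp _ _ hE v p hv hp) as [hd hps].
replace (D2 (e_vs E) v (s_vp E v p) * / D2 (p_vs E) v (s_vp E v p)) with
 (D1 (e_vs E) v (s_vp E v p) * 0 + D2 (e_vs E) v (s_vp E v p) * / D2 (p_vs E) v (s_vp E v p))
 by ring.
apply is_derive_Reals.
apply (derivable_pt_lim_comp_2d (e_vs E) (fun _ => v) (s_vp E v)).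
- apply (Ck1_differentiable (h_dom E)); [apply (eos_open _ _ hE); auto|].
  apply (eos_smooth _ _ hE).
- apply derivable_pt_lim_const.
- apply is_derive_Reals. apply (s_vp_derive_p pinf q); auto.
Qed.

(** In the explicit partial derivatives [s_vp] occurs only as an argument of derivatives of [e_vs]
    and [p_vs], so its continuity makes them continuous. *)
Lemma e_vp_C1 (pinf q : R) (E : hydro_eos) :
  complete_eos pinf E -> hydro_assumptions pinf q E ->
  Ck_on 1 (fun v p => 0 < v /\ - pinf < p) (e_vp E).
Proof.
intros hE hh.
assert (Hs : forall v p, 0 < v /\ - pinf < p -> continuity_2d_pt (s_vp E) v p)
  by (intros v p [hv hp]; apply (s_vp_continuous pinf q); auto).
assert (Hcomp : forall f : R -> R -> R,
   (forall v s, h_dom E v s -> continuity_2d_pt f v s) ->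
   forall v p, 0 < v /\ - pinf < p -> continuity_2d_pt (fun v p => f v (s_vp E v p)) v p).
{ intros f Hf v p h. apply continuity_2d_pt_comp_2; auto.
  - apply Hf. apply (eos_vp _ _ hE); apply h.
  - apply continuity_2d_pt_id1. }
destruct (eos_smooth _ _ hE 1%nat) as [Hc [_ [_ [He2 _]]]].
destruct (p_vs_Ck pinf E 1 hE) as [Hpc [_ [[Hp1 _] [Hp2 _]]]].
assert (Hinv : forall v p, 0 < v /\ - pinf < p ->
   continuity_2d_pt (fun v p => / D2 (p_vs E) v (s_vp E v p)) v p).
{ intros v p h. apply continuity_2d_pt_inv; [apply (Hcomp (D2 (p_vs E))); auto|].
  destruct (eos_vp _ _ hE v p) as [hd _]; try apply h.
  pose proof (h_dp_ds _ _ _ hh _ _ hd). lra. }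
assert (Hloc : forall v p, 0 < v /\ - pinf < p ->
   locally_2d (fun v p => 0 < v /\ - pinf < p) v p)
  by (intros v p h; apply locally_2d_quadrant; apply h).
split; [|split; [|split; split; auto]].
- apply (Hcomp (e_vs E)). exact Hc.
- intros v p [hv hp]. split.
  + eexists. apply (e_vp_derive_v pinf q); auto.
  + eexists. apply (e_vp_derive_p pinf q); auto.
- intros v p h.
  eapply continuity_2d_pt_ext_loc.
  2:{ apply (continuity_2d_pt_plus (fun _ p => - p)
        (fun v p => D2 (e_vs E) v (s_vp E v p)
           * (- D1 (p_vs E) v (s_vp E v p) / D2 (p_vs E) v (s_vp E v p)))).
      - apply continuity_2d_pt_opp, continuity_2d_pt_id2.
      - apply (continuity_2d_pt_mult (fun v p => D2 (e_vs E) v (s_vp E v p))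
          (fun v p => - D1 (p_vs E) v (s_vp E v p) / D2 (p_vs E) v (s_vp E v p))).
        + apply (Hcomp (D2 (e_vs E))); auto.
        + apply (continuity_2d_pt_mult (fun v p => - D1 (p_vs E) v (s_vp E v p))
            (fun v p => / D2 (p_vs E) v (s_vp E v p))); auto.
          apply (continuity_2d_pt_opp (fun v p => D1 (p_vs E) v (s_vp E v p))).
          apply (Hcomp (D1 (p_vs E))); auto. }
  destruct (Hloc v p h) as [d Hd]. exists d. intros v' p' h1 h2.
  destruct (Hd v' p' h1 h2). symmetry. apply is_derive_unique.
  apply (e_vp_derive_v pinf q); auto.
- intros v p h.
  eapply continuity_2d_pt_ext_loc.
  2:{ apply (continuity_2d_pt_mult (fun v p => D2 (e_vs E) v (s_vp E v p))
        (fun v p => / D2 (p_vs E) v (s_vp E v p))); auto. }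
  destruct (Hloc v p h) as [d Hd]. exists d. intros v' p' h1 h2.
  destruct (Hd v' p' h1 h2). symmetry. apply is_derive_unique.
  apply (e_vp_derive_p pinf q); auto.
Qed.

(** * Monotonicity of the entropy and sections of the domain *)

Lemma s_vp_increasing_p (pinf q : R) (E : hydro_eos) (v p1 p2 : R) :
  complete_eos pinf E -> hydro_assumptions pinf q E -> 0 < v -> - pinf < p1 -> p1 < p2 ->
  s_vp E v p1 < s_vp E v p2.
Proof.
intros hE hh hv hp h12. apply increasing_of_derive; auto. intros t ht.
assert (hd := s_vp_derive_p pinf q E v t hE hh hv ltac:(lra)).
split; [eexists; exact hd|]. erewrite is_derive_unique; [|exact hd].
apply Rinv_0_lt_compat. apply (h_dp_ds _ _ _ hh). apply (eos_vp _ _ hE); lra.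
Qed.

(* [T ds/dv|_p = de/dv|_p + p >= p + pinf > 0] and [T = dp/ds|_v de/dp|_v >= 0]
   force both the temperature and [ds/dv|_p] to be positive. *)
Lemma s_vp_increasing_v (pinf q : R) (E : hydro_eos) (v1 v2 p : R) :
  complete_eos pinf E -> hydro_assumptions pinf q E -> 0 < v1 -> v1 <= v2 -> - pinf < p ->
  s_vp E v1 p <= s_vp E v2 p.
Proof.
intros hE hh hv h12 hp.
assert (0 * (v2 - v1) <= s_vp E v2 p - s_vp E v1 p); [|lra].
apply (increment_ge (fun v => s_vp E v p)); auto. intros t ht.
assert (hd := s_vp_derive_v pinf q E t p hE hh ltac:(lra) hp).
split; [eexists; exact hd|]. erewrite is_derive_unique; [|exact hd].
assert (h1 := h_de_dv _ _ _ hh t p ltac:(lra) hp).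
assert (h2 := h_de_dp _ _ _ hh t p ltac:(lra) hp).
unfold D1, D2 in h1, h2.
erewrite is_derive_unique in h1; [|apply (e_vp_derive_v pinf q E t p hE hh); lra].
erewrite is_derive_unique in h2; [|apply (e_vp_derive_p pinf q E t p hE hh); lra].
destruct (eos_vp _ _ hE t p ltac:(lra) hp) as [hdom _].
assert (h3 := h_dp_ds _ _ _ hh _ _ hdom).
apply Rinv_0_lt_compat in h3.
set (T := D2 (e_vs E) t (s_vp E t p)) in *.
assert (hT : 0 <= T) by nra.
set (w := - D1 (p_vs E) t (s_vp E t p) / D2 (p_vs E) t (s_vp E t p)) in *.
destruct (Rle_dec 0 w) as [h|h]; auto. exfalso. nra.
Qed.

(** The domain is only assumed open, but its section at fixed [v] is the image of an interval of
    pressures under the continuous map [s_vp E v], so it contains all intermediate entropies. *)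
Lemma h_dom_section (pinf q : R) (E : hydro_eos) (v p1 p2 s : R) :
  complete_eos pinf E -> hydro_assumptions pinf q E -> 0 < v -> - pinf < p1 -> p1 <= p2 ->
  s_vp E v p1 <= s <= s_vp E v p2 -> h_dom E v s.
Proof.
intros hE hh hv hp h12 [hs1 hs2].
assert (hex : exists p, - pinf < p /\ s_vp E v p = s).
{ destruct hs1 as [hs1|hs1]; [|exists p1; auto].
  destruct hs2 as [hs2|hs2]; [|exists p2; split; [lra|auto]].
  destruct h12 as [h12|h12]; [|subst p2; lra].
  destruct (IVT_interv (fun p => s_vp E v p - s) p1 p2) as [p [hpp Hp]]; try lra.
  - intros p hpp.
    apply continuity_pt_minus; [|apply continuity_pt_const; intros ? ?; reflexivity].
    apply continuity_pt_filterlim. apply continuity_2d_pt_snd.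
    apply (s_vp_continuous pinf q); auto; lra.
  - exists p. split; lra. }
destruct hex as [p [hp' <-]]. apply (eos_vp _ _ hE); auto.
Qed.

(** Monotonicity is read off from the inverse [s_vp E v], whose argument ranges over an interval;
    integrating [D2 (p_vs E)] would first require a whole entropy segment in the domain. *)
Lemma p_vs_le (pinf q : R) (E : hydro_eos) (v p s : R) :
  complete_eos pinf E -> hydro_assumptions pinf q E -> - pinf < p ->
  h_dom E v s -> s <= s_vp E v p -> p_vs E v s <= p.
Proof.
intros hE hh hp hd hs. destruct (eos_vs _ _ hE v s hd) as [hv [hp' e]].
apply Rnot_lt_le. intros h.
assert (h' := s_vp_increasing_p pinf q E v _ _ hE hh hv hp h). lra.
Qed.

Lemma p_vs_ge (pinf q : R) (E : hydro_eos) (v p s : R) :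
  complete_eos pinf E -> hydro_assumptions pinf q E -> - pinf < p ->
  h_dom E v s -> s_vp E v p <= s -> p <= p_vs E v s.
Proof.
intros hE hh hp hd hs. destruct (eos_vs _ _ hE v s hd) as [hv [hp' e]].
apply Rnot_lt_le. intros h.
assert (h' := s_vp_increasing_p pinf q E v _ _ hE hh hv hp' h). lra.
Qed.

(** * The barotropic pressure, tangent gaps and quantitative convexity *)

Lemma hat_p_b_C2 (eb : R -> R) (t : R) :
  baro_assumptions eb -> 0 < t ->
  is_derive (hat eb) t (- hat (p_b eb) t) /\
  ex_derive (hat (p_b eb)) t /\ ex_derive (Derive (hat (p_b eb))) t.
Proof.
intros hb ht.
assert (h1 : forall r, 0 < r -> ex_derive eb r)
  by (intros r hr; exact (proj1 (b_C3 _ hb 1%nat r ltac:(lia) hr))).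
assert (h2 : forall r, 0 < r -> ex_derive (Derive eb) r)
  by (intros r hr; exact (proj1 (b_C3 _ hb 2%nat r ltac:(lia) hr))).
assert (h3 : forall r, 0 < r -> ex_derive (Derive (Derive eb)) r)
  by (intros r hr; exact (proj1 (b_C3 _ hb 3%nat r ltac:(lia) hr))).
(* A closed formula at every positive [r] is wanted because the second derivative is obtained by
   differentiating it; the third derivative of [eb] enters there. *)
assert (hP : forall r, 0 < r -> is_derive (hat (p_b eb)) r
   (- 2 / r ^ 3 * Derive eb (/ r) - / r ^ 4 * Derive (Derive eb) (/ r))).
{ intros r hr. assert (hir := Rinv_0_lt_compat r hr). unfold hat, p_b. auto_derive.
  - assert (h := h2 _ hir). repeat split; auto; lra.
  - change (Derive (fun x : R => Derive eb x) (/ r)) with (Derive (Derive eb) (/ r)).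
    field. lra. }
assert (hit := Rinv_0_lt_compat t ht).
split; [|split].
- unfold hat, p_b. auto_derive.
  + split; auto; lra.
  + change (Derive (fun x : R => eb x) (/ t)) with (Derive eb (/ t)). field. lra.
- eexists. apply hP; auto.
- apply (ex_derive_ext_loc (fun r => - 2 / r ^ 3 * Derive eb (/ r) - / r ^ 4 * Derive (Derive eb) (/ r))).
  + generalize (locally_gt 0 t ht). apply filter_imp. intros r hr. symmetry.
    apply is_derive_unique. apply hP; auto.
  + assert (t * (t * (t * 1)) <> 0) by (apply Rgt_not_eq; repeat apply Rmult_lt_0_compat; lra).
    assert (t * (t * (t * (t * 1))) <> 0) by (apply Rgt_not_eq; repeat apply Rmult_lt_0_compat; lra).
    auto_derive. repeat split; auto; lra.
Qed.

Definition tangent_gap (P : R -> R) (vL v : R) : R := P vL - P v + Derive P v * (v - vL).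

Lemma A_b_derive (eb : R -> R) (vL v : R) :
  baro_assumptions eb -> 0 < v ->
  is_derive (fun w => A_b eb w vL) v (/ 2 * tangent_gap (hat (p_b eb)) vL v).
Proof.
intros hb hv. destruct (hat_p_b_C2 eb v hb hv) as [h1 [h2 _]].
unfold A_b, tangent_gap. generalize dependent (hat (p_b eb)). intros P h1 h2.
evar_last.
- apply (is_derive_plus (K := R_AbsRing) (V := R_NormedModule)
    (fun w => hat eb w - hat eb vL) (fun w => / 2 * (P w + P vL) * (w - vL))).
  + apply (is_derive_minus (K := R_AbsRing) (V := R_NormedModule) (hat eb) (fun _ => hat eb vL));
    [exact h1|apply (is_derive_const (K := R_AbsRing) (V := R_NormedModule))].
  + assert (hP := Derive_correct _ _ h2). auto_derive; [exact h2|reflexivity].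
- unfold minus, plus, opp, zero; simpl.
  change (Derive (fun x : R => P x) v) with (Derive P v). field.
Qed.

(** The slope is nonpositive at [b] and grows at rate at least [m], so at [t] it is at most
    [- m * (b - t)]; integration gives the parabola. On an isentrope this converts convexity into a
    pressure difference. *)
Lemma convex_drop (f : R -> R) (a b m : R) :
  a <= b ->
  (forall t, a <= t <= b -> ex_derive f t /\ ex_derive (Derive f) t /\ m <= Derive (Derive f) t) ->
  Derive f b <= 0 -> m / 2 * (b - a) ^ 2 <= f a - f b.
Proof.
intros hab H hb.
assert (hslope : forall t, a <= t <= b -> Derive f t <= - m * (b - t)).
{ intros t ht. assert (m * (b - t) <= Derive f b - Derive f t); [|lra].
  apply increment_ge; [lra|]. intros u hu. apply H. lra. }
assert (0 * (b - a) <= (- f b + m / 2 * (b - b) ^ 2) - (- f a + m / 2 * (b - a) ^ 2)); [|nra].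
apply (increment_ge (fun t => - f t + m / 2 * (b - t) ^ 2)); auto. intros t ht.
destruct (H t ht) as [h1 _]. specialize (hslope t ht).
assert (hd : is_derive (fun t => - f t + m / 2 * (b - t) ^ 2) t (- Derive f t - m * (b - t))).
{ auto_derive; [exact h1|]. change (Derive (fun x : R => f x) t) with (Derive f t). field. }
split; [eexists; exact hd|]. erewrite is_derive_unique; [|exact hd]. lra.
Qed.

(** Since the tangent is taken at the moving point, the first derivatives cancel and the gap has
    derivative [Derive (Derive P) t * (t - vL)]. Its excess over the parabola vanishes at [vL] and
    does not decrease away from it on either side, whatever the sign of [m]. *)
Lemma tangent_gap_ge (P : R -> R) (vL v m : R) :
  (forall t, between v vL t ->
     ex_derive P t /\ ex_derive (Derive P) t /\ m <= Derive (Derive P) t) ->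
  m / 2 * (v - vL) ^ 2 <= tangent_gap P vL v.
Proof.
intros H.
set (C := fun t => tangent_gap P vL t - m / 2 * (t - vL) ^ 2).
assert (hC : forall t, between v vL t ->
   is_derive C t ((Derive (Derive P) t - m) * (t - vL))).
{ intros t ht. destruct (H t ht) as [h1 [h2 _]]. unfold C, tangent_gap. auto_derive.
  - auto.
  - change (Derive (fun x : R => Derive P x) t) with (Derive (Derive P) t).
    change (Derive (fun x : R => P x) t) with (Derive P t). field. }
assert (hL : C vL = 0) by (unfold C, tangent_gap; ring).
assert (hv : 0 <= C v); [|unfold C in hv; lra].
unfold between in *.
destruct (Rle_dec v vL) as [h|h].
- rewrite Rmin_left, Rmax_right in * by lra.
  assert (0 * (vL - v) <= - C vL - - C v); [|lra].
  apply (increment_ge (fun t => - C t)); auto. intros t ht.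
  assert (hd := is_derive_opp _ _ _ (hC t ht)).
  split; [eexists; exact hd|]. erewrite is_derive_unique; [|exact hd].
  unfold opp; simpl. destruct (H t ht) as [_ [_ hm]]. nra.
- rewrite Rmin_right, Rmax_left in * by lra.
  assert (0 * (v - vL) <= C v - C vL); [|lra].
  apply increment_ge; [lra|]. intros t ht.
  split; [eexists; exact (hC t ht)|]. erewrite is_derive_unique; [|exact (hC t ht)].
  destruct (H t ht) as [_ [_ hm]]. nra.
Qed.

Lemma p_vs_isentrope (pinf q : R) (E : hydro_eos) (v s : R) :
  complete_eos pinf E -> hydro_assumptions pinf q E -> h_dom E v s ->
  ex_derive (fun w => p_vs E w s) v /\ ex_derive (Derive (fun w => p_vs E w s)) v /\
  Derive (fun w => p_vs E w s) v <= 0.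
Proof.
intros hE hh hd. destruct (p_vs_Ck pinf E 2 hE) as [_ [H1 [[_ [H2 _]] _]]].
split; [exact (proj1 (H1 v s hd))|]. split; [exact (proj1 (H2 v s hd))|].
assert (h := h_sound _ _ _ hh v s hd). unfold a_h_sqr in h.
change (Derive (fun w => p_vs E w s) v) with (D1 (p_vs E) v s).
destruct (eos_vs _ _ hE v s hd) as [hv _].
assert (0 < v ^ 2) by (apply pow_lt; auto). nra.
Qed.

(** In compression, monotonicity in the volume gives [s_vp t pL <= s_vp vL pL <= s <= s_vp v p <=
    s_vp t p], so [s] lies in the section of the domain at [t]; in expansion the two states exchange
    roles. *)
Lemma between_isentrope (pinf q : R) (E : hydro_eos) (vL pL v p s t : R) :
  complete_eos pinf E -> hydro_assumptions pinf q E ->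
  0 < vL -> - pinf < pL -> 0 < v -> - pinf < p ->
  (pL <= p -> v <= vL) -> (p <= pL -> vL <= v) ->
  (pL <= p -> s_vp E vL pL <= s <= s_vp E v p) ->
  (p <= pL -> s_vp E v p <= s <= s_vp E vL pL) ->
  between v vL t -> h_dom E t s.
Proof.
intros hE hh hvL hpL hv hp c1 c2 c3 c4 ht. unfold between in ht.
destruct (Rle_dec pL p) as [h|h].
- specialize (c1 h). specialize (c3 h). rewrite Rmin_left, Rmax_right in ht by lra.
  apply (h_dom_section pinf q E t pL p); auto; [lra|].
  pose proof (s_vp_increasing_v pinf q E t vL pL hE hh ltac:(lra) ltac:(lra) hpL).
  pose proof (s_vp_increasing_v pinf q E v t p hE hh ltac:(lra) ltac:(lra) hp). lra.
- specialize (c2 ltac:(lra)). specialize (c4 ltac:(lra)). rewrite Rmin_right, Rmax_left in ht by lra.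
  apply (h_dom_section pinf q E t p pL); auto; try lra.
  pose proof (s_vp_increasing_v pinf q E t v p hE hh ltac:(lra) ltac:(lra) hp).
  pose proof (s_vp_increasing_v pinf q E vL t pL hE hh ltac:(lra) ltac:(lra) hpL). lra.
Qed.

(** The bound is stated for every [t] up to [vL], and not only at [v], because the volume bounds
    integrate along the whole segment. *)
Lemma extension_tangent_gap (pinf q : R) (E : hydro_eos) (eb : R -> R) (vL pL v p t : R) :
  complete_eos pinf E -> hydro_assumptions pinf q E -> baro_assumptions eb ->
  0 < vL -> - pinf < pL -> 0 < v -> - pinf < p ->
  extension_condition E eb vL pL (s_vp E vL pL) v p -> between v vL t ->
  - Rabs (p - pL) <= tangent_gap (hat (p_b eb)) vL t.
Proof.
intros hE hh hb hvL hpL hv hp [c1 [c2 [s [hs [mh [mb [[[tm [htm hm]] hmh] [[_ hmb] hsum]]]]]]]] ht.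
assert (hs1 : pL <= p -> s_vp E vL pL <= s <= s_vp E v p).
{ intros h. destruct (c1 h). unfold between in hs. rewrite Rmin_left, Rmax_right in hs; lra. }
assert (hs2 : p <= pL -> s_vp E v p <= s <= s_vp E vL pL).
{ intros h. destruct (c2 h). unfold between in hs. rewrite Rmin_right, Rmax_left in hs; lra. }
assert (hdom : forall u, between v vL u -> h_dom E u s).
{ intros u hu. apply (between_isentrope pinf q E vL pL v p); auto; [apply c1|apply c2]. }
(* The minimum is attained at a point of the domain, where convexity is strict. Positivity of [mh]
   lets the drop, known for [(v - vL) ^ 2], be used with the smaller [(t - vL) ^ 2]. *)
assert (mh_pos : 0 < mh) by (rewrite <- hm; apply (h_convex _ _ _ hh); auto).
assert (bv : between v vL v) by (split; [apply Rmin_l|apply Rmax_l]).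
assert (bL : between v vL vL) by (split; [apply Rmin_r|apply Rmax_r]).
assert (hiso : forall u, between v vL u -> ex_derive (fun w => p_vs E w s) u /\
   ex_derive (Derive (fun w => p_vs E w s)) u /\ mh <= Derive (Derive (fun w => p_vs E w s)) u).
{ intros u hu. destruct (p_vs_isentrope pinf q E u s hE hh (hdom u hu)) as [h1 [h2 _]].
  repeat split; auto. exact (hmh u hu). }
assert (hdrop : mh / 2 * (v - vL) ^ 2 <= Rabs (p - pL)).
{ unfold between in *. destruct (Rle_dec pL p) as [h|h].
  - destruct (c1 h) as [_ hvv]. specialize (hs1 h).
    rewrite Rmin_left, Rmax_right in * by lra. rewrite Rabs_pos_eq by lra.
    pose proof (convex_drop (fun w => p_vs E w s) v vL mh hvv hiso
      (proj2 (proj2 (p_vs_isentrope pinf q E vL s hE hh (hdom vL bL))))).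
    pose proof (p_vs_le pinf q E v p s hE hh hp (hdom v bv) ltac:(lra)).
    pose proof (p_vs_ge pinf q E vL pL s hE hh hpL (hdom vL bL) ltac:(lra)). nra.
  - destruct (c2 ltac:(lra)) as [_ hvv]. specialize (hs2 ltac:(lra)).
    rewrite Rmin_right, Rmax_left in * by lra. rewrite Rabs_left by lra.
    pose proof (convex_drop (fun w => p_vs E w s) vL v mh hvv hiso
      (proj2 (proj2 (p_vs_isentrope pinf q E v s hE hh (hdom v bv))))).
    pose proof (p_vs_ge pinf q E v p s hE hh hp (hdom v bv) ltac:(lra)).
    pose proof (p_vs_le pinf q E vL pL s hE hh hpL (hdom vL bL) ltac:(lra)). nra. }
assert (hsub : (t - vL) ^ 2 <= (v - vL) ^ 2 /\ forall u, between t vL u -> between v vL u).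
{ unfold between in *. unfold Rmin, Rmax in *.
  destruct (Rle_dec v vL); destruct (Rle_dec t vL); split; try nra; intros u hu; lra. }
destruct hsub as [hsq hsub].
assert (hgap : mb / 2 * (t - vL) ^ 2 <= tangent_gap (hat (p_b eb)) vL t).
{ apply tangent_gap_ge. intros u hu. apply hsub in hu.
  destruct (hat_p_b_C2 eb u hb) as [_ [h1 h2]].
  { apply (eos_vs _ _ hE u s). apply hdom; auto. }
  repeat split; auto. exact (hmb u hu). }
pose proof (pow2_ge_0 (t - vL)). nra.
Qed.

(** * Hugoniot curves *)

Definition C1_solution_at (U : R -> R -> Prop) (F : R -> R -> R) (g : R -> R) (x : R) : Prop :=
  U x (g x) /\ F x (g x) = 0 /\ ex_derive g x /\ continuous (Derive g) x.

Lemma C1_solution_at_ext (U : R -> R -> Prop) (F : R -> R -> R) (f g : R -> R) (x d : R) :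
  0 < d -> (forall t, Rabs (t - x) < d -> f t = g t) ->
  C1_solution_at U F f x -> C1_solution_at U F g x.
Proof.
intros hd H [h1 [h2 [h3 h4]]].
assert (hl : locally x (fun t => f t = g t)) by (exists (mkposreal d hd); exact H).
assert (hx : f x = g x) by exact (locally_singleton _ _ hl).
split; [rewrite <- hx; auto|]. split; [rewrite <- hx; auto|]. split.
- apply (ex_derive_ext_loc f); auto.
- apply (continuous_ext_loc _ (Derive f)); auto.
  generalize (locally_locally _ _ hl). apply filter_imp. intros t ht.
  apply Derive_ext_loc; auto.
Qed.

(* At a cluster point of the branch the nondegeneracy bound [c <= D2 F] passes to the limit;
   the local branch through that point then agrees with [xi] by [branch_unique]. *)
Lemma prolong (U : R -> R -> Prop) (F : R -> R -> R) (xi : R -> R) (I : R -> Prop) (x0 y0 c : R) :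
  (forall x y, U x y -> locally_2d U x y) -> Ck_on 1 U F -> 0 < c -> U x0 y0 ->
  (forall x1 x2 x, I x1 -> I x2 -> between x1 x2 x -> I x) ->
  (forall x, I x -> C1_solution_at U F xi x /\ c <= D2 F x (xi x)) ->
  (forall eps d, 0 < eps -> 0 < d ->
     exists x, I x /\ Rabs (x - x0) < d /\ Rabs (xi x - y0) < eps) ->
  exists (delta : R) (g : R -> R), 0 < delta /\
    (forall x, Rabs (x - x0) < delta -> C1_solution_at U F g x) /\
    (forall x, I x -> Rabs (x - x0) < delta -> g x = xi x).
Proof.
intros HU HF hc hU0 HI Hxi Hcl.
assert (HF1 := HF). destruct HF1 as [Hc [_ [_ [Hc2 _]]]].
(* Closed inequalities along the curve pass to the cluster point; used with [F] and [- F] to get a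
   zero, then with [D2 F]. *)
assert (hnear : forall G a, continuity_2d_pt G x0 y0 -> (forall x, I x -> a <= G x (xi x)) ->
   a <= G x0 y0).
{ intros G a HG Ha. apply Rnot_lt_le. intros h.
  assert (h' : 0 < a - G x0 y0) by lra.
  destruct (HG (mkposreal _ h')) as [d Hdd]. simpl in Hdd.
  destruct (Hcl d d (cond_pos d) (cond_pos d)) as [x [hI [h1 h2]]].
  specialize (Hdd x (xi x) h1 h2). apply Rabs_def2 in Hdd. specialize (Ha x hI). lra. }
assert (hF0 : F x0 y0 = 0).
{ assert (0 <= F x0 y0).
  { apply hnear; [exact (Hc x0 y0 hU0)|].
    intros x hx. destruct (Hxi x hx) as [[_ [-> _]] _]. lra. }
  assert (0 <= - F x0 y0); [|lra].
  apply (hnear (fun x y => - F x y)); [apply continuity_2d_pt_opp; exact (Hc x0 y0 hU0)|].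
  intros x hx. destruct (Hxi x hx) as [[_ [-> _]] _]. lra. }
assert (hD : c <= D2 F x0 y0)
  by (apply hnear; [exact (Hc2 x0 y0 hU0)|]; intros x hx; exact (proj2 (Hxi x hx))).
destruct (implicit_function U F x0 y0 1 HU HF hU0 hF0 ltac:(lra) ltac:(lra))
  as [eps [delta [g [heps [hdelta [Hg Hu]]]]]].
exists delta, g. split; [lra|]. split.
- intros x hx. destruct (Hg x hx) as [_ H]. exact H.
- intros x hI hx. symmetry.
  (* One point of the curve in the uniqueness box, from which agreement spreads to the rest of [I]
     within [delta]. *)
  destruct (Hcl eps delta) as [x1 [hI1 [h1 h2]]]; try lra.
  apply (branch_unique F g xi x0 y0 eps delta x1 x); auto.
  + intros u hu. destruct (Hg u hu) as [h [_ [_ [h' _]]]]. split; [exact h|].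
    apply (ex_derive_continuous (V := R_NormedModule)). exact h'.
  + intros u hu. destruct (Hxi u (HI _ _ _ hI1 hI hu)) as [[_ [h [h' _]]] _].
    split; [|exact h].
    apply (ex_derive_continuous (V := R_NormedModule)). exact h'.
Qed.

(** The pressure comes first because the implicit function theorem solves for the second argument.
    [RH] is convertible to the vanishing of this function. *)
Definition hugoniot (E : hydro_eos) (eb : R -> R) (vL pL p v : R) : R :=
  e_vp E v p - e_vp E vL pL + / 2 * (p + pL) * (v - vL) + A_b eb v vL.

Definition quadrant (pinf p v : R) : Prop := - pinf < p /\ 0 < v.

Lemma hugoniot_derive_p (pinf q : R) (E : hydro_eos) (eb : R -> R) (vL pL p v : R) :
  complete_eos pinf E -> hydro_assumptions pinf q E -> quadrant pinf p v ->
  is_derive (fun r => hugoniot E eb vL pL r v) p (D2 (e_vp E) v p + / 2 * (v - vL)).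
Proof.
intros hE hh [hp hv]. destruct (e_vp_C1 pinf q E hE hh) as [_ [Hd _]].
assert (h := proj2 (Hd v p (conj hv hp))). unfold hugoniot, D2.
generalize dependent (e_vp E v). intros f h.
auto_derive; [exact h|]. change (Derive (fun x => f x) p) with (Derive f p). ring.
Qed.

Lemma hugoniot_derive_v (pinf q : R) (E : hydro_eos) (eb : R -> R) (vL pL p v : R) :
  complete_eos pinf E -> hydro_assumptions pinf q E -> baro_assumptions eb -> quadrant pinf p v ->
  is_derive (hugoniot E eb vL pL p) v
    (D1 (e_vp E) v p + / 2 * (p + pL) + / 2 * tangent_gap (hat (p_b eb)) vL v).
Proof.
intros hE hh hb [hp hv]. destruct (e_vp_C1 pinf q E hE hh) as [_ [Hd _]].
assert (h1 := proj1 (Hd v p (conj hv hp))).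
apply (is_derive_plus (K := R_AbsRing) (V := R_NormedModule)
  (fun w => e_vp E w p - e_vp E vL pL + / 2 * (p + pL) * (w - vL)) (fun w => A_b eb w vL)).
- auto_derive; [exact h1|]. unfold D1. ring.
- apply A_b_derive; auto.
Qed.

Lemma quadrant_open (pinf p v : R) : quadrant pinf p v -> locally_2d (quadrant pinf) p v.
Proof. intros [hp hv]. apply locally_2d_quadrant; auto. Qed.

Lemma hugoniot_C1 (pinf q : R) (E : hydro_eos) (eb : R -> R) (vL pL : R) :
  complete_eos pinf E -> hydro_assumptions pinf q E -> baro_assumptions eb ->
  Ck_on 1 (quadrant pinf) (hugoniot E eb vL pL).
Proof.
intros hE hh hb. destruct (e_vp_C1 pinf q E hE hh) as [Hc [_ [[H1 _] [H2 _]]]].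
assert (hswap : forall f : R -> R -> R,
   (forall v p, 0 < v /\ - pinf < p -> continuity_2d_pt f v p) ->
   forall p v, quadrant pinf p v -> continuity_2d_pt (fun p v => f v p) p v).
{ intros f Hf p v [hp hv].
  apply (continuity_2d_pt_comp_2 f (fun _ v => v) (fun p _ => p)).
  - apply Hf; auto.
  - apply continuity_2d_pt_id2.
  - apply continuity_2d_pt_id1. }
assert (hlift : forall (f : R -> R) p v, continuous f v -> continuity_2d_pt (fun _ w => f w) p v).
{ intros f p v Hf. apply (continuity_1d_2d_pt_comp f (fun _ w => w)).
  - apply continuity_pt_filterlim; auto.
  - apply continuity_2d_pt_id2. }
assert (hmid : forall p v, continuity_2d_pt (fun p _ => / 2 * (p + pL)) p v).
{ intros p v. apply (continuity_2d_pt_mult (fun _ _ => / 2) (fun p _ => p + pL)).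
  - apply continuity_2d_pt_const.
  - apply (continuity_2d_pt_plus (fun p _ => p) (fun _ _ => pL)).
    + apply continuity_2d_pt_id1.
    + apply continuity_2d_pt_const. }
assert (hsub : forall p v, continuity_2d_pt (fun _ v => v - vL) p v).
{ intros p v. apply (continuity_2d_pt_minus (fun _ v => v) (fun _ _ => vL)).
  - apply continuity_2d_pt_id2.
  - apply continuity_2d_pt_const. }
assert (hloc : forall (f g : R -> R -> R) p v, quadrant pinf p v ->
   (forall p v, quadrant pinf p v -> f p v = g p v) -> continuity_2d_pt f p v ->
   continuity_2d_pt g p v).
{ intros f g p v h He. apply continuity_2d_pt_ext_loc.
  destruct (quadrant_open pinf p v h) as [d Hd]. exists d. intros; apply He; auto. }
split; [|split; [|split; split; auto]].
- intros p v h.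
  apply (continuity_2d_pt_plus
    (fun p v => e_vp E v p - e_vp E vL pL + / 2 * (p + pL) * (v - vL)) (fun _ v => A_b eb v vL)).
  + apply (continuity_2d_pt_plus (fun p v => e_vp E v p - e_vp E vL pL)
      (fun p v => / 2 * (p + pL) * (v - vL))).
    * apply (continuity_2d_pt_minus (fun p v => e_vp E v p) (fun _ _ => e_vp E vL pL)).
      -- exact (hswap (e_vp E) Hc p v h).
      -- apply continuity_2d_pt_const.
    * exact (continuity_2d_pt_mult _ _ p v (hmid p v) (hsub p v)).
  + apply (hlift (fun v => A_b eb v vL)).
    apply (ex_derive_continuous (V := R_NormedModule)). eexists.
    exact (A_b_derive eb vL v hb (proj2 h)).
- intros p v h. split; eexists.
  + exact (hugoniot_derive_p pinf q E eb vL pL p v hE hh h).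
  + exact (hugoniot_derive_v pinf q E eb vL pL p v hE hh hb h).
- intros p v h.
  apply (hloc (fun p v => D2 (e_vp E) v p + / 2 * (v - vL))); [exact h| |].
  + intros p' v' h'. symmetry. apply is_derive_unique.
    exact (hugoniot_derive_p pinf q E eb vL pL p' v' hE hh h').
  + apply (continuity_2d_pt_plus (fun p v => D2 (e_vp E) v p) (fun _ v => / 2 * (v - vL))).
    * exact (hswap (D2 (e_vp E)) H2 p v h).
    * apply (continuity_2d_pt_mult (fun _ _ => / 2) (fun _ v => v - vL)).
      -- apply continuity_2d_pt_const.
      -- exact (hsub p v).
- intros p v h.
  apply (hloc (fun p v => D1 (e_vp E) v p + / 2 * (p + pL)
      + / 2 * tangent_gap (hat (p_b eb)) vL v)); [exact h| |].
  + intros p' v' h'. symmetry. apply is_derive_unique.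
    exact (hugoniot_derive_v pinf q E eb vL pL p' v' hE hh hb h').
  + apply (continuity_2d_pt_plus (fun p v => D1 (e_vp E) v p + / 2 * (p + pL))
      (fun _ v => / 2 * tangent_gap (hat (p_b eb)) vL v)).
    * apply (continuity_2d_pt_plus (fun p v => D1 (e_vp E) v p) (fun p _ => / 2 * (p + pL))).
      -- exact (hswap (D1 (e_vp E)) H1 p v h).
      -- exact (hmid p v).
    * apply (hlift (fun v => / 2 * tangent_gap (hat (p_b eb)) vL v)).
      destruct (hat_p_b_C2 eb v hb (proj2 h)) as [_ [h1 h2]].
      apply (ex_derive_continuous (V := R_NormedModule)). unfold tangent_gap.
      generalize dependent (hat (p_b eb)). intros P h1 h2. auto_derive. split; [exact h1|].
      split; [exact h2|exact I].
Qed.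

(** The gap term costs at most |p - pL|/2, and (p + pL)/2 - |p - pL|/2 is the smaller pressure; the
    energy contributes [pinf]. At [t = v] this is the nondegeneracy needed for continuation. *)
Lemma hugoniot_derive_v_ge (pinf q : R) (E : hydro_eos) (eb : R -> R) (vL pL v p t : R) :
  complete_eos pinf E -> hydro_assumptions pinf q E -> baro_assumptions eb ->
  0 < vL -> - pinf < pL -> 0 < v -> - pinf < p ->
  extension_condition E eb vL pL (s_vp E vL pL) v p -> between v vL t ->
  pinf + Rmin p pL <= D2 (hugoniot E eb vL pL) p t.
Proof.
intros hE hh hb hvL hpL hv hp hc ht.
assert (h1 := extension_tangent_gap pinf q E eb vL pL v p t hE hh hb hvL hpL hv hp hc ht).
assert (ht0 : 0 < t).
{ destruct ht as [ht _]. eapply Rlt_le_trans; [|exact ht]. apply Rmin_pos; auto. }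
change (D2 (hugoniot E eb vL pL) p t) with (Derive (hugoniot E eb vL pL p) t).
rewrite (is_derive_unique _ _ _ (hugoniot_derive_v pinf q E eb vL pL p t hE hh hb (conj hp ht0))).
assert (h2 := h_de_dv _ _ _ hh t p ht0 hp).
unfold Rmin, Rabs in *. destruct (Rle_dec p pL); destruct (Rcase_abs (p - pL)); lra.
Qed.

(** * Bounds for the volume along the curve *)

Lemma e_vp_le (pinf q : R) (E : hydro_eos) (v p1 p2 : R) :
  complete_eos pinf E -> hydro_assumptions pinf q E -> 0 < v -> - pinf < p1 -> p1 <= p2 ->
  e_vp E v p1 <= e_vp E v p2.
Proof.
intros hE hh hv hp h12.
assert (0 * (p2 - p1) <= e_vp E v p2 - e_vp E v p1); [|lra].
apply (increment_ge (e_vp E v)); auto. intros t ht.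
split; [eexists; apply (e_vp_derive_p pinf q); auto; lra|].
apply (h_de_dp _ _ _ hh v t hv). lra.
Qed.

(* If [v] were small, [A_b <= (p - pL) (vL - v) / 2] would leave
   [e_h(v, b) >= q + (pinf + pL) vL / 2], against [e_h(v, b) -> q]. *)
Lemma compression_lower_bound (pinf q : R) (E : hydro_eos) (eb : R -> R) (vL pL b : R) :
  complete_eos pinf E -> hydro_assumptions pinf q E -> baro_assumptions eb ->
  0 < vL -> - pinf < pL ->
  exists m, 0 < m /\ forall v p, 0 < v -> pL <= p < b ->
    extension_condition E eb vL pL (s_vp E vL pL) v p -> hugoniot E eb vL pL p v = 0 -> m <= v.
Proof.
intros hE hh hb hvL hpL.
destruct (Rle_dec b pL) as [hbp|hbp].
{ exists 1. split; [lra|]. intros v p hv hp. lra. }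
assert (hk : 0 < (pinf + pL) * (vL / 2)) by (apply Rmult_lt_0_compat; lra).
destruct (h_e_lim _ _ _ hh b ltac:(lra) (fun y => Rabs (y - q) < (pinf + pL) * (vL / 2)))
  as [d Hd].
{ exists (mkposreal _ hk). intros y hy. exact hy. }
assert (hd := cond_pos d).
exists (Rmin d (vL / 2)). split; [apply Rmin_pos; lra|].
intros v p hv hp hc hRH. apply Rnot_lt_le. intros hlt.
pose proof (Rmin_l d (vL / 2)). pose proof (Rmin_r d (vL / 2)).
assert (hlim : e_vp E v b - q < (pinf + pL) * (vL / 2)).
{ apply Rabs_def2. apply Hd; [|lra]. change (Rabs (v - 0) < d).
  rewrite Rminus_0_r, Rabs_pos_eq; lra. }
(* Trading [p] for the fixed [b] lets the single limit at [b] give a bound uniform in [p]. *)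
assert (heb : e_vp E v p <= e_vp E v b) by (apply (e_vp_le pinf q); auto; lra).
assert (hEL : pinf * (vL - v) <= e_vp E vL pL - e_vp E v pL).
{ apply (increment_ge (fun w => e_vp E w pL)); [lra|]. intros t ht.
  split; [eexists; apply (e_vp_derive_v pinf q); auto; lra|].
  apply (h_de_dv _ _ _ hh t pL); lra. }
assert (hq := h_e_ge _ _ _ hh v pL hv hpL).
assert (hA : - / 2 * (p - pL) * (vL - v) <= A_b eb vL vL - A_b eb v vL).
{ apply (increment_ge (fun w => A_b eb w vL)); [lra|]. intros t ht.
  assert (hA := A_b_derive eb vL t hb ltac:(lra)).
  split; [eexists; exact hA|]. erewrite is_derive_unique; [|exact hA].
  assert (hg := extension_tangent_gap pinf q E eb vL pL v p t hE hh hb hvL hpL hv ltac:(lra) hc).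
  rewrite Rabs_pos_eq in hg by lra.
  specialize (hg ltac:(unfold between; rewrite Rmin_left, Rmax_right; lra)). lra. }
assert (hA0 : A_b eb vL vL = 0) by (unfold A_b; ring).
unfold hugoniot in hRH. nra.
Qed.

(** On the segment from [vL] to [v] the function [hugoniot E eb vL pL p] has slope at least
    [pinf + p]; it vanishes at [v] and is at least [q - e_vp E vL pL] at [vL]. Hence [(pinf + p) *
    (v - vL) <= e_vp E vL pL - q], and [p > a > - pinf] makes the bound uniform. *)
Lemma expansion_upper_bound (pinf q : R) (E : hydro_eos) (eb : R -> R) (vL pL a : R) :
  complete_eos pinf E -> hydro_assumptions pinf q E -> baro_assumptions eb ->
  0 < vL -> - pinf < pL -> - pinf < a ->
  exists M, forall v p, 0 < v -> a < p <= pL ->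
    extension_condition E eb vL pL (s_vp E vL pL) v p -> hugoniot E eb vL pL p v = 0 -> v <= M.
Proof.
intros hE hh hb hvL hpL ha.
exists (vL + (e_vp E vL pL - q) / (pinf + a)). intros v p hv hp hc hRH.
assert (hvv : vL <= v) by (destruct hc as [_ [c _]]; apply c; lra).
assert (hinc : (pinf + p) * (v - vL) <= hugoniot E eb vL pL p v - hugoniot E eb vL pL p vL).
{ apply (increment_ge (hugoniot E eb vL pL p)); auto. intros t ht.
  split; [eexists; apply (hugoniot_derive_v pinf q); auto; split; lra|].
  apply Rle_trans with (pinf + Rmin p pL); [rewrite Rmin_left; lra|].
  apply (hugoniot_derive_v_ge pinf q E eb vL pL v p t); auto; [lra|].
  unfold between. rewrite Rmin_right, Rmax_left; lra. }
assert (hq := h_e_ge _ _ _ hh vL p hvL ltac:(lra)).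
assert (hA0 : A_b eb vL vL = 0) by (unfold A_b; ring).
assert (hL : hugoniot E eb vL pL p vL = e_vp E vL p - e_vp E vL pL)
  by (unfold hugoniot; rewrite hA0; ring).
assert (h : (v - vL) * (pinf + a) <= e_vp E vL pL - q) by nra.
apply (Rmult_le_reg_r (pinf + a)); [lra|].
replace ((vL + (e_vp E vL pL - q) / (pinf + a)) * (pinf + a))
  with (vL * (pinf + a) + (e_vp E vL pL - q)) by (field; lra).
lra.
Qed.

Lemma solution_curve_iff (pinf : R) (E : hydro_eos) (eb : R -> R) (vL pL : R) (a b : Rbar)
    (xi : R -> R) :
  solution_curve pinf E eb vL pL a b xi <->
  Rbar_lt a pL /\ Rbar_lt pL b /\ xi pL = vL /\
  forall p : R, Rbar_lt a p -> Rbar_lt p b ->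
    C1_solution_at (quadrant pinf) (hugoniot E eb vL pL) xi p.
Proof.
unfold solution_curve, C1_solution_at, quadrant.
split; intros [h1 [h2 [h3 h4]]]; (split; [exact h1|split; [exact h2|split; [exact h3|]]]);
  intros p ha hb.
- destruct (h4 p ha hb) as [k1 [k2 [k3 k4]]]. exact (conj (conj k1 k2) (conj k3 k4)).
- destruct (h4 p ha hb) as [[k1 k2] [k3 k4]]. exact (conj k1 (conj k2 (conj k3 k4))).
Qed.

Theorem proposition3p9 (pinf q : R) (E : hydro_eos) (eb : R -> R)
    (hE : complete_eos pinf E) (hh : hydro_assumptions pinf q E)
    (hb : baro_assumptions eb)
    (vL pL sL : R) (hvL : 0 < vL) (hpL : - pinf < pL) (hsL : sL = s_vp E vL pL) :
  (exists (eps delta : R) (xi : R -> R),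
     0 < eps <= vL /\ 0 < delta <= pL + pinf /\
     solution_curve pinf E eb vL pL (pL - delta) (pL + delta) xi /\
     (forall p, pL - delta < p < pL + delta -> vL - eps < xi p < vL + eps) /\
     (forall v p, vL - eps < v < vL + eps -> pL - delta < p < pL + delta ->
        (RH E eb vL pL v p <-> v = xi p)))
  /\
  (forall (a : Rbar) (b : R) (xi : R -> R),
     solution_curve pinf E eb vL pL a b xi ->
     (forall p, pL <= p < b -> extension_condition E eb vL pL sL (xi p) p) ->
     exists (b' : R) (eta : R -> R),
       b < b' /\ solution_curve pinf E eb vL pL a b' eta /\
       (forall p : R, Rbar_lt a p -> p < b -> eta p = xi p))
  /\
  (forall (a : R) (b : Rbar) (xi : R -> R),
     - pinf < a ->
     solution_curve pinf E eb vL pL a b xi ->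
     (forall p, a < p <= pL -> extension_condition E eb vL pL sL (xi p) p) ->
     exists (a' : R) (eta : R -> R),
       a' < a /\ solution_curve pinf E eb vL pL a' b eta /\
       (forall p : R, a < p -> Rbar_lt p b -> eta p = xi p)).
Proof.
subst sL.
assert (HC := hugoniot_C1 pinf q E eb vL pL hE hh hb).
assert (HU := quadrant_open pinf).
split; [|split].
- assert (h0 : hugoniot E eb vL pL pL vL = 0) by (unfold hugoniot, A_b; ring).
  (* At the base point the tangent gap vanishes, leaving at least [pinf + pL]. *)
  assert (hpos : 0 < D2 (hugoniot E eb vL pL) pL vL).
  { change (D2 (hugoniot E eb vL pL) pL vL) with (Derive (hugoniot E eb vL pL pL) vL).
    rewrite (is_derive_unique _ _ _
      (hugoniot_derive_v pinf q E eb vL pL pL vL hE hh hb (conj hpL hvL))).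
    assert (h := h_de_dv _ _ _ hh vL pL hvL hpL).
    replace (tangent_gap (hat (p_b eb)) vL vL) with 0 by (unfold tangent_gap; ring). lra. }
  assert (hr : 0 < Rmin vL (pL + pinf)) by (apply Rmin_pos; lra).
  destruct (implicit_function _ _ pL vL (Rmin vL (pL + pinf)) HU HC (conj hpL hvL) h0 hpos hr)
    as [eps [delta [g [heps [hdelta [Hg Hu]]]]]].
  pose proof (Rmin_l vL (pL + pinf)). pose proof (Rmin_r vL (pL + pinf)).
  exists eps, delta, g. split; [lra|]. split; [lra|]. split; [|split].
  + apply solution_curve_iff. simpl. split; [lra|]. split; [lra|]. split.
    * symmetry. apply Hu; [rewrite Rminus_diag, Rabs_R0; lra|rewrite Rminus_diag, Rabs_R0; lra|].
      exact h0.
    * intros p h1 h2. apply Hg. apply Rabs_def1; lra.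
  + intros p hp. destruct (Hg p) as [h _]; [apply Rabs_def1; lra|]. apply Rabs_def2 in h. lra.
  + intros v p hv hp.
    assert (hp' : Rabs (p - pL) < delta) by (apply Rabs_def1; lra).
    split.
    * intros h. apply Hu; [exact hp'|apply Rabs_def1; lra|exact h].
    * intros ->. exact (proj1 (proj2 (proj2 (Hg p hp')))).
- intros a b xi hxi hext. apply solution_curve_iff in hxi. destruct hxi as [ha [hb' [hL Hxi]]].
  simpl in hb'.
  assert (HI : forall p, pL <= p < b -> C1_solution_at (quadrant pinf) (hugoniot E eb vL pL) xi p).
  { intros p hp. apply Hxi; [|simpl; lra]. eapply Rbar_lt_le_trans; [exact ha|]. simpl. lra. }
  destruct (compression_lower_bound pinf q E eb vL pL b hE hh hb hvL hpL) as [m [hm Hm]].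
  destruct (cluster_point (fun h => xi (b - h)) (b - pL) m vL) as [v0 [hv0 Hcl]]; [lra| |].
  { intros h hr. destruct (HI (b - h) ltac:(lra)) as [[_ h1] [h2 _]].
    assert (hc := hext (b - h) ltac:(lra)). split.
    - apply (Hm _ (b - h)); [exact h1|lra|exact hc|exact h2].
    - destruct hc as [c _]. apply c. lra. }
  (* In compression the smaller of the two pressures is [pL], whence the constant [pinf + pL]. *)
  destruct (prolong (quadrant pinf) (hugoniot E eb vL pL) xi (fun p => pL < p < b) b v0 (pinf + pL))
    as [delta [g [hdelta [Hg Hgx]]]]; [exact HU|exact HC|lra|split; lra| | | |].
  + intros x1 x2 x h1 h2 [h3 h4]. unfold Rmin, Rmax in *. destruct (Rle_dec x1 x2); lra.
  + intros x hx. assert (hs := HI x ltac:(lra)). split; [exact hs|]. destruct hs as [[_ hpos] _].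
    apply Rle_trans with (pinf + Rmin x pL); [rewrite Rmin_right; lra|].
    apply (hugoniot_derive_v_ge pinf q E eb vL pL (xi x));
      [exact hE|exact hh|exact hb|exact hvL|exact hpL|exact hpos|lra|apply hext; lra|].
    split; [apply Rmin_l|apply Rmax_l].
  + intros eps d h1 h2. destruct (Hcl eps d h1 h2) as [h [hh1 [hh2 hh3]]].
    exists (b - h). split; [lra|]. split; [apply Rabs_def1; lra|exact hh3].
  (* The two pieces agree on an interval before [b], so around each point [eta] coincides with [xi]
     or with [g], and being a C^1 solution is a local property. *)
  + set (eta := fun p => if Rlt_dec p b then xi p else g p).
    assert (eta_l : forall p, p < b -> eta p = xi p)
      by (intros p hp; unfold eta; destruct (Rlt_dec p b); [reflexivity|lra]).
    assert (eta_g : forall p, pL < p -> Rabs (p - b) < delta -> eta p = g p).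
    { intros p h1 h2. unfold eta. destruct (Rlt_dec p b) as [h|h]; [|reflexivity].
      symmetry. apply Hgx; [lra|exact h2]. }
    exists (b + delta), eta. split; [lra|]. split; [|intros p _; exact (eta_l p)].
    apply solution_curve_iff. split; [exact ha|]. split; [simpl; lra|].
    split; [rewrite eta_l by lra; exact hL|].
    intros p h1 h2. simpl in h2. destruct (Rlt_dec p b) as [hp|hp].
    * apply (C1_solution_at_ext _ _ xi eta p (b - p)); [lra| |apply Hxi; [exact h1|exact hp]].
      intros t ht. apply Rabs_def2 in ht. symmetry. apply eta_l. lra.
    (* This radius keeps [t] above [pL] and within [delta] of [b], where [eta] is known to equal
       [g]. *)
    * assert (hd : 0 < Rmin (b + delta - p) (Rmin (b - pL) delta)) by (repeat apply Rmin_pos; lra).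
      apply (C1_solution_at_ext _ _ g eta p _ hd); [|apply Hg; apply Rabs_def1; lra].
      intros t ht. pose proof (Rmin_l (b + delta - p) (Rmin (b - pL) delta)).
      pose proof (Rmin_r (b + delta - p) (Rmin (b - pL) delta)).
      pose proof (Rmin_l (b - pL) delta). pose proof (Rmin_r (b - pL) delta).
      apply Rabs_def2 in ht. symmetry. apply eta_g; [lra|]. apply Rabs_def1; lra.
- intros a b xi ha0 hxi hext. apply solution_curve_iff in hxi. destruct hxi as [ha [hb' [hL Hxi]]].
  simpl in ha.
  assert (HI : forall p, a < p <= pL -> C1_solution_at (quadrant pinf) (hugoniot E eb vL pL) xi p).
  { intros p hp. apply Hxi; [simpl; lra|]. eapply Rbar_le_lt_trans; [|exact hb']. simpl. lra. }
  destruct (expansion_upper_bound pinf q E eb vL pL a hE hh hb hvL hpL ha0) as [M HM].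
  destruct (cluster_point (fun h => xi (a + h)) (pL - a) vL M) as [v0 [hv0 Hcl]]; [lra| |].
  { intros h hr. destruct (HI (a + h) ltac:(lra)) as [[_ h1] [h2 _]].
    assert (hc := hext (a + h) ltac:(lra)). split.
    - destruct hc as [_ [c _]]. apply c. lra.
    - apply (HM _ (a + h)); [exact h1|lra|exact hc|exact h2]. }
  (* In expansion the smaller pressure is [p > a], whence the constant [pinf + a], positive because
     [- pinf < a]. *)
  destruct (prolong (quadrant pinf) (hugoniot E eb vL pL) xi (fun p => a < p < pL) a v0 (pinf + a))
    as [delta [g [hdelta [Hg Hgx]]]]; [exact HU|exact HC|lra|split; lra| | | |].
  + intros x1 x2 x h1 h2 [h3 h4]. unfold Rmin, Rmax in *. destruct (Rle_dec x1 x2); lra.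
  + intros x hx. assert (hs := HI x ltac:(lra)). split; [exact hs|]. destruct hs as [[_ hpos] _].
    apply Rle_trans with (pinf + Rmin x pL); [rewrite Rmin_left; lra|].
    apply (hugoniot_derive_v_ge pinf q E eb vL pL (xi x));
      [exact hE|exact hh|exact hb|exact hvL|exact hpL|exact hpos|lra|apply hext; lra|].
    split; [apply Rmin_l|apply Rmax_l].
  + intros eps d h1 h2. destruct (Hcl eps d h1 h2) as [h [hh1 [hh2 hh3]]].
    exists (a + h). split; [lra|]. split; [apply Rabs_def1; lra|exact hh3].
  + set (eta := fun p => if Rlt_dec a p then xi p else g p).
    assert (eta_l : forall p, a < p -> eta p = xi p)
      by (intros p hp; unfold eta; destruct (Rlt_dec a p); [reflexivity|lra]).
    assert (eta_g : forall p, p < pL -> Rabs (p - a) < delta -> eta p = g p).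
    { intros p h1 h2. unfold eta. destruct (Rlt_dec a p) as [h|h]; [|reflexivity].
      symmetry. apply Hgx; [lra|exact h2]. }
    exists (a - delta), eta. split; [lra|]. split; [|intros p h _; exact (eta_l p h)].
    apply solution_curve_iff. split; [simpl; lra|]. split; [exact hb'|].
    split; [rewrite eta_l by lra; exact hL|].
    intros p h1 h2. simpl in h1. destruct (Rlt_dec a p) as [hp|hp].
    * apply (C1_solution_at_ext _ _ xi eta p (p - a)); [lra| |apply Hxi; [exact hp|exact h2]].
      intros t ht. apply Rabs_def2 in ht. symmetry. apply eta_l. lra.
    * assert (hd : 0 < Rmin (p - (a - delta)) (Rmin (pL - a) delta))
        by (repeat apply Rmin_pos; lra).
      apply (C1_solution_at_ext _ _ g eta p _ hd); [|apply Hg; apply Rabs_def1; lra].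
      intros t ht. pose proof (Rmin_l (p - (a - delta)) (Rmin (pL - a) delta)).
      pose proof (Rmin_r (p - (a - delta)) (Rmin (pL - a) delta)).
      pose proof (Rmin_l (pL - a) delta). pose proof (Rmin_r (pL - a) delta).
      apply Rabs_def2 in ht. symmetry. apply eta_g; [lra|]. apply Rabs_def1; lra.
Qed.
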